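(* For any $l\ge1$ and any permutation $\sigma\in S_l$, \[ \frac{\prod_{i<j}(1-q\,t\,x_iy_j)}{\prod_{i\le j}(1-t\,x_iy_j)}=\sum_{\mathbf a\ge0}t^{|\mathbf a|}\,E^\sigma_{\mathbf a}(x_1,\dots,x_l;q^{-1})\,F^\sigma_{\mathbf a}(y_1,\dots,y_l;q), \] where the sum is over $\mathbf a=(a_1,\dots,a_l)\in\mathbb Z_{\ge0}^l$, $|\mathbf a|=a_1+\dots+a_l$, and the left side is expanded as a power series in $t$.
   Context: Let $\mathbf k$ be a field containing $\mathbb Q(q)$. $S_l$ acts on $\mathbb Z^l$ by $w(\lambda)=(\lambda_{w^{-1}(1)},\dots,\lambda_{w^{-1}(l)})$ and on $\mathbf k[x_1^{\pm1},\dots,x_l^{\pm1}]$ by $w(x_i)=x_{w(i)}$. $s_i=(i,i+1)$, $w_0(i)=l+1-i$. Demazure–Lusztig operators: $T_i=q\,s_i+(1-q)\frac{1}{1-x_{i+1}/x_i}(s_i-1)$, $1\le i<l$; they satisfy the braid relations and $(T_i-q)(T_i+1)=0$, and $T_w=T_{i_1}\cdots T_{i_m}$ for a reduced word $w=s_{i_1}\cdots s_{i_m}$. For $\lambda\in\mathbb Z^l$ let $\lambda_+$ be its weakly decreasing rearrangement and $E_\lambda(x;q)=q^{-\ell(w)}T_wx^{\lambda_+}$ for any $w$ with $w(\lambda_+)=\lambda$ (independent of choice). $\mathrm{Inv}(\mu)=\{(i,j):i<j,\mu_i>\mu_j\}$, $\mathrm{Inv}(\pi)=\mathrm{Inv}(\pi(1),\dots,\pi(l))$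 for a permutation, and $\mathrm{Inv}(\lambda+\epsilon\rho)=\{(i,j):i<j,\lambda_i\ge\lambda_j\}$. Define $E^\sigma_\lambda(x;q)=q^{|\mathrm{Inv}(\sigma^{-1})\cap\mathrm{Inv}(\lambda+\epsilon\rho)|}T_{\sigma^{-1}}^{-1}E_{\sigma^{-1}(\lambda)}(x;q)$ and $F^\sigma_\lambda(x;q)=E^{\sigma w_0}_{-\lambda}(x_1^{-1},\dots,x_l^{-1};q^{-1})$ (non-symmetric Hall–Littlewood polynomials). *)

(* Defs.v *)
From HB Require Import structures.
From Stdlib Require Import ClassicalEpsilon.
From mathcomp Require Import all_boot all_order all_fingroup all_algebra.
From mathcomp Require Import generic_quotient mpoly.
From mathcomp Require Import zify.

Set Implicit Arguments.
Unset Strict Implicit.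
Unset Printing Implicit Defensive.

Import Order.TTheory GRing.Theory Num.Theory.
Local Open Scope ring_scope.

(* Laurent polynomials in m variables over k are handled inside the field
   k(x_0, ..., x_{m-1}), where the denominators of the Demazure-Lusztig
   operators make sense literally. Variables are indexed from 0. *)
Notation ratfun k m := {fraction {mpoly k[m]}}.

Section RationalFunctions.
Context (k : fieldType).

Definition rC (m : nat) (c : k) : ratfun k m := tofrac (mpolyC m c).
Definition rX (m : nat) (i : 'I_m) : ratfun k m :=
  tofrac ('X_i : {mpoly k[m]}).

(* f(v_0, ..., v_{m-1}), computed on a representative num/den of f; it does
   not depend on the representative when the v_i are algebraically independent
   over k, which is the only case used below (rsubst_frac). *)
Definition rsubst (m p : nat) (v : 'I_m -> ratfun k p) (f : ratfun k m) :
    ratfun k p :=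
  mmap (@rC p) v (\n_(generic_quotient.repr f))
  / mmap (@rC p) v (\d_(generic_quotient.repr f)).

Lemma rsubst_frac (m p : nat) (v : 'I_m -> ratfun k p) (a b : {mpoly k[m]}) :
    injective (mmap (@rC p) v) -> b != 0 ->
  rsubst v (tofrac a / tofrac b) = mmap (@rC p) v a / mmap (@rC p) v b.
Proof.
pose rCm : {rmorphism k -> ratfun k p} := @tofrac _ \o @mpolyC p k.
have mmapM : {morph mmap (@rC p) v : x y / x * y}.
  exact: (rmorphM (mmap rCm v)).
have mmap0 : mmap (@rC p) v 0 = 0 by exact: (rmorph0 (mmap rCm v)).
move=> inj_v nz_b; rewrite /rsubst; set r := generic_quotient.repr _.
have nz x : x != 0 -> mmap (@rC p) v x != 0.
  by move=> nz_x; rewrite -mmap0 (inj_eq inj_v).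
have rE : tofrac a / tofrac b = tofrac \n_r / tofrac \d_r.
  rewrite -[LHS]reprK -/r -[in LHS](Ratio_numden r).
  rewrite -[tofrac _]/(FracField.tofrac _) !piE.
  apply: congr1; have nz1 := oner_neq0 {mpoly k[m]}.
  by rewrite /FracField.mulf /FracField.invf !numden_Ratio ?denom_ratioP // mulr1 mul1r.
have nz_d : \d_r != 0 by exact: denom_ratioP.
have nzF x : x != 0 -> tofrac x != 0 :> ratfun k m by rewrite tofrac_eq0.
have /eqP := rE; rewrite eqr_div ?nzF // -!tofracM tofrac_eq => /eqP.
by move/(congr1 (mmap (@rC p) v)) => E; apply/eqP; rewrite eqr_div ?nz // -!mmapM E.
Qed.

End RationalFunctions.

Notation weight l := {ffun 'I_l -> int}.

Section Weights.
Context (l : nat).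
Implicit Types (lam : weight l) (w : 'S_l).

Definition wact w lam : weight l := [ffun i => lam ((w^-1)%g i)].

Definition wplus lam : weight l :=
  [ffun i : 'I_l => nth 0 (sort >=%O (codom lam)) i].

Lemma wplus_ex lam : exists w, wact w (wplus lam) == lam.
Proof.
pose t := [tuple lam i | i < l].
have ct : codom lam = t :> seq int by rewrite codomE /=; apply: eq_map.
have /tuple_permP [p sE] : perm_eq (sort >=%O (codom lam)) t.
  by rewrite perm_sort ct.
exists p; apply/eqP/ffunP=> i; rewrite !ffunE sE.
by rewrite (nth_map i) ?size_enum_ord // nth_ord_enum tnth_mktuple permKV.
Qed.

Definition perm_Inv w : {set 'I_l * 'I_l} :=
  [set ij : 'I_l * 'I_l | (ij.1 < ij.2)%N && (w ij.2 < w ij.1)%N].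

Definition eps_Inv lam : {set 'I_l * 'I_l} :=
  [set ij : 'I_l * 'I_l | (ij.1 < ij.2)%N && (lam ij.2 <= lam ij.1)].

Definition w0 : 'S_l := perm (@rev_ord_inj l).

End Weights.

Section ReducedWords.
Context (n : nat).

Definition sref (i : 'I_n) : 'S_n.+1 :=
  tperm (widen_ord (leqnSn n) i) (lift ord0 i).

(* (u * v)%g is "u, then v", so this is the composite s_{i_1} o ... o s_{i_m}
   of functions for the word [:: i_1; ...; i_m]. *)
Definition word_perm (s : seq 'I_n) : 'S_n.+1 :=
  foldr (fun i w => (w * sref i)%g) 1%g s.

Lemma word_perm_cat s1 s2 :
  word_perm (s1 ++ s2) = (word_perm s2 * word_perm s1)%g.
Proof. by elim: s1 => [|i s1 IH] /=; rewrite ?mulg1 // IH mulgA. Qed.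

Lemma word_perm_tperm (i j : 'I_n.+1) : exists s, word_perm s = tperm i j.
Proof.
wlog le_ij : i j / (i <= j)%N.
  by move=> W; case: (leqP i j) => [|/ltnW] /W // [s]; exists s; rewrite tpermC.
elim: {j}(val j) {-2}j (erefl (val j)) le_ij => [|m IH] j jE le_ij.
  have jE' : nat_of_ord j = 0%N := jE.
  by exists [::]; rewrite (_ : j = i) ?tperm1 //; apply/ord_inj; lia.
have jE' : nat_of_ord j = m.+1 := jE.
have [->|ne_ij] := eqVneq i j; first by exists [::]; rewrite tperm1.
have lt_mn : (m < n)%N by move: (ltn_ord j); lia.
pose a := Ordinal lt_mn; pose j' := widen_ord (leqnSn n) a.
have aE : sref a = tperm j' j.
  by congr tperm; apply: val_inj; rewrite /= jE.
have [iE|ne_ij'] := eqVneq i j'; first by exists [:: a]; rewrite /= mul1g aE iE.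
have [||s sE] := IH j'; [by []| |].
  by move: ne_ij; rewrite -val_eqE /= jE; lia.
exists (a :: rcons s a); rewrite -cats1 -cat1s !word_perm_cat /= mul1g sE aE.
rewrite -[X in (X * _ * _)%g]tpermV -mulgA -conjgE.
by rewrite (tpermC i) tpermJ_tperm 1?eq_sym // tpermC.
Qed.

Lemma word_perm_ex (w : 'S_n.+1) :
  exists m, [exists s : m.-tuple 'I_n, word_perm s == w].
Proof.
suff [s <-] : exists s, word_perm s = w.
  by exists (size s); apply/existsP; exists (in_tuple s).
have [ts -> _] := prod_tpermP w.
elim: ts => [|t ts [s IH]]; first by exists [::]; rewrite big_nil.
have [s' s'E] := word_perm_tperm t.1 t.2.
by exists (s ++ s'); rewrite word_perm_cat big_cons IH s'E.
Qed.

Definition ell (w : 'S_n.+1) : nat := ex_minn (word_perm_ex w).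

Lemma reduced_word_ex (w : 'S_n.+1) :
  exists s : (ell w).-tuple 'I_n, word_perm s == w.
Proof. by apply/existsP; rewrite /ell; case: ex_minnP. Qed.

Definition reduced_word (w : 'S_n.+1) : seq 'I_n :=
  xchoose (reduced_word_ex w).

End ReducedWords.

Section HallLittlewood.
Context (k : fieldType) (n : nat).
Local Notation K := (ratfun k n.+1).
Implicit Types (q : k) (lam : weight n.+1) (w sigma : 'S_n.+1) (f : K).

Definition ract w f : K := rsubst (fun i => rX k (w i)) f.

Definition xmon lam : K := \prod_i rX k i ^ lam i.

Definition DLop q (i : 'I_n) f : K :=
  rC _ q * ract (sref i) f
  + (1 - rC _ q)
    * (1 / (1 - rX k (lift ord0 i) / rX k (widen_ord (leqnSn n) i)))
    * (ract (sref i) f - f).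

(* Independent of the chosen reduced word, by the braid relations. *)
Definition DLperm q w f : K := foldr (DLop q) f (reduced_word w).

(* T_w^{-1} f: the g with T_w g = f (T_w is bijective for q != 0 by the
   quadratic relations). *)
Definition DLperm_inv q w f : K :=
  epsilon (inhabits (0 : K)) (fun g => DLperm q w g = f).

(* Independent of the chosen w with w(lam_+) = lam, since T_i acts by q on
   monomials with equal exponents at i and i + 1. *)
Definition nsE q lam : K :=
  let w := xchoose (wplus_ex lam) in
  (rC _ q) ^- ell w * DLperm q w (xmon (wplus lam)).

Definition nsE_sigma q sigma lam : K :=
  (rC _ q) ^+ #|perm_Inv (sigma^-1)%g :&: eps_Inv lam|
  * DLperm_inv q (sigma^-1)%g (nsE q (wact (sigma^-1)%g lam)).

(* (w0 _ * sigma)%g is the composite sigma o w_0 of functions. *)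
Definition nsF_sigma q sigma lam : K :=
  rsubst (fun i => (rX k i)^-1) (nsE_sigma q^-1 (w0 _ * sigma)%g (- lam)).

End HallLittlewood.

Section PowerSeries.
Context (K : fieldType).
Implicit Types P Q : {poly K}.

Fixpoint expand_seq P Q (d : nat) : seq K :=
  if d is d'.+1 then
    let s := expand_seq P Q d' in
    rcons s ((P`_d' - \sum_(i < d') Q`_(d' - i) * s`_i) / Q`_0)
  else [::].

(* Coefficient of t^d in the power series expansion of P(t) / Q(t), for
   Q(0) != 0; see expand_mul. *)
Definition expand P Q (d : nat) : K := (expand_seq P Q d.+1)`_d.

Lemma expand_mul P Q (d : nat) : Q`_0 != 0 ->
  \sum_(i < d.+1) Q`_(d - i) * expand P Q i = P`_d.
Proof.
move=> nzQ; have szE m : size (expand_seq P Q m) = m.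
  by elim: m => //= m IH; rewrite size_rcons IH.
have nthE m i : (i < m)%N -> (expand_seq P Q m)`_i = expand P Q i.
  elim: m => // m IH; rewrite ltnS leq_eqVlt => /predU1P[-> //|lt_im].
  by rewrite /= nth_rcons szE lt_im IH.
rewrite big_ord_recr /= subnn /expand /= nth_rcons szE ltnn eqxx.
rewrite mulrC divfK // addrC -[RHS](subrK (\sum_(i < d) Q`_(d - i) * (expand_seq P Q d)`_i)).
by congr (_ + _); apply: eq_bigr => i _; rewrite nthE.
Qed.

End PowerSeries.

Definition weight_of (l : nat) (a : 'X_{1..l}) : weight l :=
  [ffun i => (a i)%:Z].

(* Main.v *)
(** Write p = q^-1, T_i for the Demazure-Lusztig operators at parameter p, T'_i for
    their conjugates under inversion of the variables, and Z for the left-hand side.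
    Expanding the definitions, with tau = sigma^-1 the right-hand side is
      sum_b p^(N b) (T_tau^-1 E_b)(x) ((T'_(w0 tau))^-1 E_(-w0 b))(y^-1),
    where N b = #{i < j : b_i <= b_j} does not depend on sigma. As Z is annihilated
    by T_i(x) - T'_i(y), everything reduces to sigma = w0, that is to
    Z = sum_a H_a(x) G_a(y) with H_a = p^(N (w0 a)) T_w0^-1 E_(w0 a) and
    G_a(y) = E_(-a)(y^-1).

    In degree d the coefficient matrix B of Z is unitriangular for the dominance
    order. The pairing of y-polynomials with x-polynomials given by B^-1 makes T'_i
    adjoint to T_i, so B = sum_a H_a G_a^T as soon as (G_a, H_c) = [a = c]. The
    recursions for H and G reduce this to antidominant a, where G_a = y^a. There one
    compares |b|^2 = sum_i b_i^2: the operators T_i do not increase it, H_c is x^c plus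
    terms of smaller norm, and moving up in dominance order from a dominant weight, or
    down from an antidominant one, strictly increases it. *)

Require Import Defs.
From HB Require Import structures.
From Stdlib Require Import ClassicalEpsilon.
From mathcomp Require Import all_boot all_order all_fingroup all_algebra.
From mathcomp Require Import generic_quotient mpoly.
From mathcomp Require Import zify ring.

Set Implicit Arguments.
Unset Strict Implicit.
Unset Printing Implicit Defensive.

Import Order.TTheory GRing.Theory Num.Theory.
Local Open Scope ring_scope.

(** * Substitution in rational functions *)

(** The pairing is the inverse of the kernel matrix because all that is asked of it then comes from
    Z itself: invariance of Z is adjointness of the operators, and the Neumann series of a
    unitriangular matrix stays triangular. The norm is used since it hides what T_w does inside an
    orbit: modulo smaller norm T_i x^a = p x^(s_i a) + (p - 1) x^a when a_i > a_(i+1), so going from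
    H_a to H_(s_i a) by T_i^-1 cancels the second term exactly, and no Bruhat order is needed.

    The non-negative weights of degree d form a finite set stable under the T_i, so the work is done
    with matrices over k; the y-side uses the negated weights because F is defined through y^-1 and
    -a. General sigma reduces to w0 because the lengths of tau and w0 tau add up to that of w0: T_w0
    = T_tau T_((w0 tau)^-1), and the second factor can be carried across the kernel. *)

Section RationalMorphisms.
Context (k : fieldType).

HB.instance Definition _ (m : nat) :=
  GRing.RMorphism.copy (@rC k m) (@tofrac {mpoly k[m]} \o @mpolyC m k).

Lemma rX_neq0 (m : nat) (i : 'I_m) : rX k i != 0.
Proof. by rewrite tofrac_eq0 -msupp_eq0 msuppX. Qed.

Lemma rX_inj (m : nat) : injective (@rX k m).
Proof.
move=> i j /eqP; rewrite tofrac_eq => /eqP/(congr1 (mcoeff U_(i))).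
rewrite !mcoeffX eqxx eq_mnm1 eq_sym; case: eqP => // _ /eqP.
by rewrite /= oner_eq0.
Qed.

Lemma ratfun_frac (m : nat) (f : ratfun k m) :
  exists a b : {mpoly k[m]}, b != 0 /\ f = tofrac a / tofrac b.
Proof.
elim/quotW: f => r; exists \n_r, \d_r; have nz_d := denom_ratioP r.
split=> //; rewrite -[in LHS](Ratio_numden r) -[tofrac _]/(FracField.tofrac _).
rewrite !piE; apply: congr1; have nz1 := oner_neq0 {mpoly k[m]}.
by rewrite /FracField.mulf /FracField.invf !numden_Ratio ?denom_ratioP // mulr1 mul1r.
Qed.

Definition lmon (m : nat) (lam : weight m) : ratfun k m :=
  \prod_i rX k i ^ lam i.

Lemma lmonD m (a b : weight m) : lmon (a + b) = lmon a * lmon b.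
Proof.
by rewrite -big_split; apply: eq_bigr => i _; rewrite ffunE expfzDr ?rX_neq0.
Qed.

Lemma lmon_nat m (a : 'X_{1..m}) : lmon (weight_of a) = tofrac 'X_[a].
Proof.
rewrite mpolyXE_id rmorph_prod; apply: eq_bigr => i _.
by rewrite ffunE rmorphXn.
Qed.

Lemma lmon_indep m (T : eqType) (W : T -> weight m) (c : T -> k) (s : seq T) :
    uniq s -> {in s &, injective W} ->
    \sum_(z <- s) rC m (c z) * lmon (W z) = 0 ->
  forall z, z \in s -> c z = 0.
Proof.
move=> us injW s0 z0 z0s.
(* [M] bounds every exponent, so multiplying by (x_0 ... x_(m-1))^M turns the relation into one
   between distinct polynomial monomials. *)
pose M : nat := \sum_(z <- s) \sum_i `|W z i|%N.
have leM z i : z \in s -> (`|W z i| <= M)%N.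
  move=> zs; rewrite /M (bigD1_seq z) //= (bigD1 i) //=.
  by rewrite -addnA leq_addr.
pose mm z := [multinom absz (W z i + M%:Z)%R | i < m].
have mmE z : z \in s -> W z + [ffun=> M%:Z] = weight_of (mm z).
  move=> zs; apply/ffunP => i; rewrite !ffunE mnmE /=; have := leM z i zs.
  set w := W z i; clearbody w => wM; lia.
have : \sum_(z <- s) c z *: 'X_[mm z] = 0 :> {mpoly k[m]}.
  apply/eqP; rewrite -tofrac_eq0 rmorph_sum /=.
  rewrite (eq_big_seq (fun z => rC m (c z) * lmon (W z) * lmon [ffun=> M%:Z])).
    by rewrite -mulr_suml s0 mul0r.
  by move=> z zs; rewrite -mulrA -lmonD mmE // lmon_nat -mul_mpolyC rmorphM.
move/(congr1 (mcoeff (mm z0))); rewrite mcoeff0 raddf_sum /=.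
rewrite (bigD1_seq z0) //= mcoeffZ mcoeffX eqxx mulr1 big_seq_cond big1 ?addr0 //.
move=> z /andP[zs zz0]; rewrite mcoeffZ mcoeffX; case: eqP => [E|]; last by rewrite mulr0.
case/eqP: zz0; apply: injW => //; apply: (@addIr _ [ffun=> M%:Z]).
by rewrite !mmE // E.
Qed.

Definition alg_indep m p (v : 'I_m -> ratfun k p) :=
  injective (mmap (@rC k p) v).

Lemma lmon_alg_indep m p (v : 'I_m -> ratfun k p) (W : 'X_{1..m} -> weight p) :
    injective W -> (forall a, mmap1 v a = lmon (W a)) ->
  alg_indep v.
Proof.
move=> injW vE; apply: raddf_inj => f f0.
have : \sum_(a <- msupp f) rC p f@_a * lmon (W a) = 0.
  by rewrite -[RHS]f0; apply: eq_bigr => a _; rewrite vE.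
move/(lmon_indep (msupp_uniq f) (in2W injW)) => {}f0.
apply/mpolyP => a; rewrite mcoeff0; case: (boolP (a \in msupp f)) => [/f0 //|].
exact: memN_msupp_eq0.
Qed.

Lemma alg_indep_rX m p (g : 'I_m -> 'I_p) :
  injective g -> alg_indep (fun i => rX k (g i)).
Proof.
move=> injg; pose W (a : 'X_{1..m}) : weight p :=
  [ffun j => \sum_(i | g i == j) (a i)%:Z].
have WE a i : W a (g i) = a i.
  rewrite ffunE (big_pred1 i) // => j; exact: inj_eq.
apply: (@lmon_alg_indep _ _ _ W).
  by move=> a b /ffunP E; apply/mnmP => i; have := E (g i); rewrite !WE => -[].
move=> a; rewrite /mmap1 /lmon (partition_big g xpredT) //=; apply: eq_bigr => j _.
rewrite ffunE; elim/big_rec2: _ => [|i y1 y2 /eqP gi ->]; first by rewrite expr0z.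
by rewrite gi expfzDr ?rX_neq0.
Qed.

Lemma alg_indep_rXV m : alg_indep (fun i : 'I_m => (rX k i)^-1).
Proof.
apply: (@lmon_alg_indep _ _ _ (fun a => - weight_of a)).
  by move=> a b /oppr_inj/ffunP E; apply/mnmP => i; have := E i; rewrite !ffunE => -[].
move=> a; apply: eq_bigr => i _; rewrite !ffunE exprVn.
by rewrite -invr_expz.
Qed.

Section Subst.
Context (m p : nat) (v : 'I_m -> ratfun k p).

(** The proof of independence is a phantom argument to which the structure of a ring morphism can be
    attached; without it [rsubst v] need not be a morphism. *)
Definition subst_of of alg_indep v := rsubst v.

Context (iv : alg_indep v).
Local Notation phi := (subst_of iv).
Local Notation psi := (mmap (@rC k p) v).

Let psi_neq0 a : a != 0 -> psi a != 0.
Proof. by move=> nz; rewrite -(raddf0 psi) (inj_eq iv). Qed.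

Let phiE a b : b != 0 -> phi (tofrac a / tofrac b) = psi a / psi b.
Proof. exact: rsubst_frac. Qed.

Let phi_tofrac a : phi (tofrac a) = psi a.
Proof.
rewrite -[tofrac a]divr1 -(rmorph1 (@tofrac {mpoly k[m]})) phiE ?oner_neq0 //.
by rewrite rmorph1 divr1.
Qed.

Fact subst_of_zmod_morphism : zmod_morphism phi.
Proof.
move=> f g; have [a [b [nb ->]]] := ratfun_frac f.
have [c [e [ne ->]]] := ratfun_frac g.
rewrite -mulNr addf_div ?tofrac_eq0 // -!(rmorphN, rmorphM, rmorphD).
rewrite !phiE ?mulf_neq0 // -mulNr addf_div ?psi_neq0 //.
by rewrite !(rmorphN, rmorphM, rmorphD).
Qed.

Fact subst_of_monoid_morphism : monoid_morphism phi.
Proof.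
split; first by rewrite -(rmorph1 (@tofrac {mpoly k[m]})) phi_tofrac rmorph1.
move=> f g; have [a [b [nb ->]]] := ratfun_frac f.
have [c [e [ne ->]]] := ratfun_frac g.
rewrite mulf_div -!rmorphM !phiE ?mulf_neq0 // mulf_div.
by rewrite !rmorphM.
Qed.

HB.instance Definition _ :=
  GRing.isZmodMorphism.Build _ _ phi subst_of_zmod_morphism.
HB.instance Definition _ :=
  GRing.isMonoidMorphism.Build _ _ phi subst_of_monoid_morphism.

Lemma subst_of_rC c : phi (rC m c) = rC p c.
Proof. by rewrite phi_tofrac mmapC. Qed.

Lemma subst_of_rX i : phi (rX k i) = v i.
Proof. by rewrite phi_tofrac mmapX mmap1U. Qed.

End Subst.

Lemma ratfun_morph_eq m (L : fieldType) (f g : {rmorphism ratfun k m -> L}) :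
    (forall c, f (rC m c) = g (rC m c)) -> (forall i, f (rX k i) = g (rX k i)) ->
  f =1 g.
Proof.
move=> eC eX.
have eP a : f (tofrac a) = g (tofrac a).
  elim/mpolyind: a => [|c e a _ _ IH]; first by rewrite !rmorph0.
  rewrite !rmorphD IH -mul_mpolyC !rmorphM; congr (_ * _ + _); first exact: eC.
  rewrite mpolyXE_id !rmorph_prod; apply: eq_bigr => i _.
  by rewrite !rmorphXn; congr (_ ^+ _); exact: eX.
by move=> h; have [a [b [_ ->]]] := ratfun_frac h; rewrite !fmorph_div !eP.
Qed.

End RationalMorphisms.

(** * Demazure-Lusztig operators *)

Section DemazureLusztigAlgebra.
Context (L : fieldType).
Implicit Types p x y z f : L.

(* With f1 standing for s f, this is the value at f of the operator
   p s + (1 - p) / (1 - y / x) (s - 1). *)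
Definition dl p x y f f1 : L := p * f1 + (1 - p) * (1 / (1 - y / x)) * (f1 - f).

Let dlE p x y f f1 : x != 0 -> x != y ->
  dl p x y f f1 = p * f1 + (1 - p) * (x / (x - y)) * (f1 - f).
Proof.
move=> nx; rewrite -subr_eq0 => nxy; rewrite /dl; congr (_ + _ * _ * _).
by rewrite -[in 1 - _](divff nx) -mulrBl invf_div mul1r.
Qed.

Lemma dl_quad p x y f f1 : x != 0 -> y != 0 -> x != y ->
  dl p x y (dl p x y f f1) (dl p y x f1 f) = (p - 1) * dl p x y f f1 + p * f.
Proof.
move=> nx ny nxy; have nyx : y != x by rewrite eq_sym.
rewrite !dlE //; field; rewrite !subr_eq0 ?nyx ?nxy //.
Qed.

Lemma dl_comm p x y z t f0 f1 f2 f12 : x != 0 -> z != 0 -> x != y -> z != t ->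
  dl p x y (dl p z t f0 f2) (dl p z t f1 f12)
  = dl p z t (dl p x y f0 f1) (dl p x y f2 f12).
Proof.
by move=> nx nz nxy nzt; rewrite !dlE //; field; rewrite !subr_eq0 ?nxy ?nzt //.
Qed.

(** The six values are the images of f under S_3, with [f12] for s_i s_j f, and x, y, z are three
    consecutive variables. Taken as independent unknowns they make the braid relation a rational
    identity that [field] decides. *)
Lemma dl_braid p x y z f0 f1 f2 f12 f21 f121 :
    x != 0 -> y != 0 -> z != 0 -> x != y -> y != z -> x != z ->
  dl p x y (dl p y z (dl p x y f0 f1) (dl p x z f2 f21))
           (dl p x z (dl p y x f1 f0) (dl p y z f12 f121))
  = dl p y z (dl p x y (dl p y z f0 f2) (dl p x z f1 f12))
             (dl p x z (dl p z y f2 f0) (dl p x y f21 f121)).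
Proof.
move=> nx ny nz nxy nyz nxz.
have nyx : y != x by rewrite eq_sym.
have nzy : z != y by rewrite eq_sym.
rewrite !dlE //; field; rewrite !subr_eq0 ?nxy ?nyz ?nxz ?nyx ?nzy //.
Qed.

End DemazureLusztigAlgebra.

Local Notation ract := Defs.ract.

Section DemazureLusztigOperators.
Context (k : fieldType) (n : nat).
Local Notation K := (ratfun k n.+1).
Implicit Types (p c : k) (i j : 'I_n) (w : 'S_n.+1) (f g : K).

Definition ract_indep w : alg_indep (fun a => rX k (w a)) :=
  @alg_indep_rX k _ _ _ (@perm_inj _ w).

HB.instance Definition _ w :=
  GRing.RMorphism.copy (@ract k n w) (subst_of (@ract_indep w)).

Lemma ract_rX w (a : 'I_n.+1) : ract w (rX k a) = rX k (w a).
Proof. exact: (subst_of_rX (@ract_indep w)). Qed.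

Lemma ract_rC w c : ract w (rC _ c) = rC _ c.
Proof. exact: (subst_of_rC (@ract_indep w)). Qed.

Lemma ractM u w f : ract u (ract w f) = ract (w * u)%g f.
Proof.
apply: (@ratfun_morph_eq _ _ _ (ract u \o ract w) (ract (w * u)%g)) => [c|a] /=.
  by rewrite !ract_rC.
by rewrite !ract_rX permM.
Qed.

Lemma ract1 f : ract 1%g f = f.
Proof.
apply: (@ratfun_morph_eq _ _ _ (ract 1%g) idfun) => [c|a] /=.
  by rewrite !ract_rC.
by rewrite !ract_rX perm1.
Qed.

Definition lo i : 'I_n.+1 := widen_ord (leqnSn n) i.
Definition hi i : 'I_n.+1 := lift ord0 i.

Lemma lo_neq_hi i : lo i != hi i.
Proof. by rewrite -val_eqE /= /bump /=; lia. Qed.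

Lemma srefE i : sref i = tperm (lo i) (hi i). Proof. by []. Qed.
Lemma sref_lo i : sref i (lo i) = hi i. Proof. by rewrite srefE tpermL. Qed.
Lemma sref_hi i : sref i (hi i) = lo i. Proof. by rewrite srefE tpermR. Qed.
Lemma srefK i : (sref i * sref i = 1)%g. Proof. exact: tperm2. Qed.
Lemma srefV i : ((sref i)^-1 = sref i)%g. Proof. exact: tpermV. Qed.
Lemma sref_fix i a : lo i != a -> hi i != a -> sref i a = a.
Proof. by move=> ? ?; rewrite srefE tpermD. Qed.

Lemma rX_eq (a b : 'I_n.+1) : (rX k a == rX k b) = (a == b).
Proof. exact: (inj_eq (@rX_inj k n.+1)). Qed.

Lemma DLopE p i f :
  DLop p i f = dl (rC _ p) (rX k (lo i)) (rX k (hi i)) f (ract (sref i) f).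
Proof. by []. Qed.

Lemma ract_dl w p x y f g :
  ract w (dl (rC _ p) x y f g) = dl (rC _ p) (ract w x) (ract w y) (ract w f) (ract w g).
Proof.
by rewrite /dl rmorphD !(rmorphM, rmorphB, fmorphV, rmorph1) /= ract_rC.
Qed.

Fact DLop_zmod_morphism p i : zmod_morphism (@DLop k n p i).
Proof. by move=> f g; rewrite !DLopE /dl rmorphB; ring. Qed.

HB.instance Definition _ p i :=
  GRing.isZmodMorphism.Build _ _ (@DLop k n p i) (DLop_zmod_morphism p i).

Lemma DLopZ p i c f : DLop p i (rC _ c * f) = rC _ c * DLop p i f.
Proof. by rewrite !DLopE /dl rmorphM /= ract_rC; ring. Qed.

Lemma DLop_quad p i f :
  DLop p i (DLop p i f) = (rC _ p - 1) * DLop p i f + rC _ p * f.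
Proof.
rewrite [in LHS]DLopE {2}DLopE ract_dl !ract_rX sref_lo sref_hi ractM srefK ract1.
rewrite [in X in dl _ _ _ X _]DLopE dl_quad ?rX_neq0 ?rX_eq ?lo_neq_hi //.
Qed.

Lemma sref_comm i j : (i.+1 < j)%N -> (sref i * sref j = sref j * sref i)%g.
Proof.
move=> ij; apply: perm_onC (tperm_on _ _) (tperm_on _ _) _.
rewrite -setI_eq0; apply/eqP/setP => a; rewrite !inE -!val_eqE /= /bump /=.
by apply/negP; move=> /andP[/orP[]/eqP-> /orP[]/eqP]; lia.
Qed.

Lemma DLop_comm p i j f : (i.+1 < j)%N ->
  DLop p i (DLop p j f) = DLop p j (DLop p i f).
Proof.
move=> ij.
have fix1 : sref i (lo j) = lo j by apply: sref_fix; rewrite -val_eqE /= ?/bump /=; lia.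
have fix2 : sref i (hi j) = hi j by apply: sref_fix; rewrite -val_eqE /= ?/bump /=; lia.
have fix3 : sref j (lo i) = lo i by apply: sref_fix; rewrite -val_eqE /= ?/bump /=; lia.
have fix4 : sref j (hi i) = hi i by apply: sref_fix; rewrite -val_eqE /= ?/bump /=; lia.
rewrite !DLopE !ract_dl !ract_rX fix1 fix2 fix3 fix4 !ractM -sref_comm //.
by rewrite dl_comm ?rX_neq0 ?rX_eq ?lo_neq_hi.
Qed.

Lemma sref_braid i j : j = i.+1 :> nat ->
  (sref i * sref j * sref i = sref j * sref i * sref j)%g.
Proof.
move=> ji; have hl : hi i = lo j by apply/val_inj; rewrite /= /bump /=; lia.
rewrite -{1}(srefV i) -{2}(srefV j) -!mulgA -!conjgE !srefE hl.
rewrite (tpermC (lo i)) !tpermJ_tperm -?val_eqE /= ?/bump /=; try lia.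
exact: tpermC.
Qed.

Lemma DLop_braid p i j f : j = i.+1 :> nat ->
  DLop p i (DLop p j (DLop p i f)) = DLop p j (DLop p i (DLop p j f)).
Proof.
move=> ji; have hl : hi i = lo j by apply/val_inj; rewrite /= /bump /=; lia.
have fix2 : sref i (hi j) = hi j by apply: sref_fix; rewrite -val_eqE /= ?/bump /=; lia.
have fix3 : sref j (lo i) = lo i by apply: sref_fix; rewrite -val_eqE /= ?/bump /=; lia.
have E1 : sref i (lo i) = lo j by rewrite -hl sref_lo.
have E2 : sref i (lo j) = lo i by rewrite -hl sref_hi.
have braid := sref_braid ji.
have d1 : lo i != lo j by rewrite -val_eqE /=; lia.
have d2 : lo i != hi j by rewrite -val_eqE /= /bump; lia.
rewrite !DLopE hl !ract_dl !(ract_rX, E1, E2, fix2, fix3, sref_lo, sref_hi).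
rewrite !ractM !srefK !ract1 braid.
by rewrite hl dl_braid ?rX_neq0 ?rX_eq ?d1 ?d2 ?lo_neq_hi.
Qed.

End DemazureLusztigOperators.

(** * Length and reduced words *)

Section Length.
Context (n : nat).
Implicit Types (i j : 'I_n) (a b : 'I_n.+1) (w u : 'S_n.+1) (s r : seq 'I_n).

Definition ninv w := #|perm_Inv w|.

(* i is a left descent of w, i.e. s_i o w is shorter than w. *)
Definition ldes w i := ((w^-1)%g (hi i) < (w^-1)%g (lo i))%N.

Lemma sref_lt i a b : (a < b)%N -> (a, b) != (lo i, hi i) ->
  (sref i a < sref i b)%N.
Proof.
move=> ab ne; have {}ne : ~~ ((a == i :> nat) && (b == i.+1 :> nat)).
  apply: contra ne => /andP[/eqP ea /eqP eb]; apply/eqP.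
  by congr pair; apply/val_inj.
have val c : sref i c = (if c == i :> nat then i.+1 else if c == i.+1 :> nat then nat_of_ord i else nat_of_ord c) :> nat.
  rewrite srefE; case: tpermP => [->|->|/eqP c1 /eqP c2].
  - by rewrite /= eqxx.
  - by rewrite /= eqxx; case: eqP => //; rewrite /bump /=; lia.
  move: c1 c2; rewrite -!val_eqE /= /bump /= add1n => c1 c2.
  by rewrite (negPf c1) (negPf c2).
by rewrite !val; move: ab ne; do !case: eqP => //=; lia.
Qed.

Lemma ldes_sref w i : ldes (w * sref i) i = ~~ ldes w i.
Proof.
rewrite /ldes invMg !permM srefV sref_lo sref_hi -leqNgt ltn_neqAle val_eqE.
by rewrite (inj_eq perm_inj) lo_neq_hi.
Qed.

Lemma perm_Inv_sref w i : ~~ ldes w i ->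
  perm_Inv (w * sref i) = ((w^-1)%g (lo i), (w^-1)%g (hi i)) |: perm_Inv w.
Proof.
move=> nd; apply/setP => -[a b]; rewrite !inE /= !permM.
have lt_ab : ((w^-1)%g (lo i) < (w^-1)%g (hi i))%N.
  by rewrite ltn_neqAle val_eqE (inj_eq perm_inj) lo_neq_hi leqNgt.
case: eqP => [[-> ->]|ne] /=.
  by rewrite lt_ab !permKV sref_lo sref_hi ltnSn.
case: ltnP => //= ab.
have ne1 : (w a, w b) != (lo i, hi i).
  by apply: contra_notN ne => /eqP[<- <-]; rewrite !permK.
have ne2 : (w b, w a) != (lo i, hi i).
  apply/eqP => -[Eb Ea]; move: lt_ab; rewrite -Ea -Eb !permK; lia.
case: (ltngtP (w a) (w b)) => [lt|gt|/val_inj/perm_inj E].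
- by apply/negbTE; rewrite -leqNgt ltnW // sref_lt.
- exact: sref_lt.
by rewrite E ltnn in ab.
Qed.

Lemma ninv_up w i : ~~ ldes w i -> ninv (w * sref i) = (ninv w).+1.
Proof.
move=> nd; rewrite /ninv perm_Inv_sref // cardsU1 inE /= !permKV.
by rewrite [(hi i < lo i)%N]ltnNge leqnSn andbF.
Qed.

Lemma ninv_down w i : ldes w i -> ninv w = (ninv (w * sref i)).+1.
Proof.
move=> d; rewrite -(@ninv_up _ i) ?ldes_sref ?d // -mulgA srefK mulg1 //.
Qed.

Lemma ninv_srefE w i :
  ninv (w * sref i) = if ldes w i then (ninv w).-1 else (ninv w).+1.
Proof. by case: ifP => [/ninv_down->|/negbT/ninv_up]. Qed.

Lemma ninv1 : ninv 1%g = 0%N.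
Proof.
apply/eqP; rewrite cards_eq0; apply/eqP/setP => -[a b]; rewrite !inE /= !perm1.
by case: ltngtP.
Qed.

Lemma ldes_ex w : w != 1%g -> exists i, ldes w i.
Proof.
move=> nw; apply/existsP; apply: contraR nw => /existsPn nd.
suff E a : (w^-1)%g a = a.
  by rewrite -(inj_eq invg_inj) invg1; apply/eqP/permP => a; rewrite perm1.
have up i : ((w^-1)%g (lo i) < (w^-1)%g (hi i))%N.
  by rewrite ltn_neqAle val_eqE (inj_eq perm_inj) lo_neq_hi leqNgt nd.
(* Each step of w^-1 raises the value by at least one; comparing a with the last index and then with
   the first gives w^-1 a <= a and a <= w^-1 a. *)
have mono (b c : nat) (hb : (b < n.+1)%N) (hc : (c < n.+1)%N) : (b <= c)%N ->
    ((w^-1)%g (Ordinal hb) + (c - b) <= (w^-1)%g (Ordinal hc))%N.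
  elim: c hc => [|c IH] hc bc.
    have -> : Ordinal hb = Ordinal hc by apply/val_inj; rewrite /=; lia.
    by rewrite sub0n addn0.
  have [E|neq] := eqVneq b c.+1.
    by subst b; rewrite subnn addn0 (bool_irrelevance hb hc).
  have hc' : (c < n)%N by [].
  have lo' : lo (Ordinal hc') = Ordinal (ltnW hc) by apply/val_inj.
  have hi' : hi (Ordinal hc') = Ordinal hc by apply/val_inj.
  have := up (Ordinal hc'); rewrite lo' hi'.
  have := IH (ltnW hc); lia.
apply/ord_inj/eqP; rewrite eqn_leq; apply/andP; split.
  have := mono a n (ltn_ord a) (ltnSn n) (ltn_ord a : (a <= n)%N).
  have -> : Ordinal (ltn_ord a) = a by apply/val_inj.
  have := ltn_ord ((w^-1)%g (Ordinal (ltnSn n))); have := ltn_ord a; lia.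
have := mono 0%N a (ltn0Sn n) (ltn_ord a) (leq0n a).
have -> : Ordinal (ltn_ord a) = a by apply/val_inj.
lia.
Qed.

Lemma ninv_word s : (ninv (word_perm s) <= size s)%N.
Proof.
elim: s => [|i s IH] /=; first by rewrite ninv1.
by rewrite ninv_srefE; case: ifP => _; lia.
Qed.

Lemma ninv_word_ex w : exists2 s, size s = ninv w & word_perm s = w.
Proof.
elim: {w}(ninv w) {-2}w (erefl (ninv w)) => [|m IH] w wm.
  have [->|/ldes_ex[i /ninv_down]] := eqVneq w 1%g; last by rewrite wm.
  by exists [::]; rewrite ?ninv1.
have [E|/ldes_ex[i di]] := eqVneq w 1%g; first by rewrite E ninv1 in wm.
have [|s sz sw] := IH (w * sref i)%g; first by have := ninv_down di; lia.
exists (i :: s); first by rewrite /= sz -(ninv_down di).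
by rewrite /= sw -mulgA srefK mulg1.
Qed.

Lemma ell_ninv w : ell w = ninv w.
Proof.
rewrite /ell; case: ex_minnP => m /existsP[s /eqP sw] min_m.
apply/eqP; rewrite eqn_leq; apply/andP; split.
  have [r sz rw] := ninv_word_ex w; apply: min_m; rewrite -sz.
  by apply/existsP; exists (in_tuple r); rewrite /= rw.
by have := ninv_word s; rewrite size_tuple sw.
Qed.

Definition reduced s := size s == ninv (word_perm s).

Lemma reduced_wordP w : word_perm (reduced_word w) = w /\ reduced (reduced_word w).
Proof.
rewrite /reduced_word; have /eqP E := xchooseP (reduced_word_ex w).
by split=> //; rewrite /reduced E size_tuple ell_ninv.
Qed.

Lemma reduced_cons i s :
  reduced (i :: s) = reduced s && ~~ ldes (word_perm s) i.
Proof.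
rewrite /reduced /= ninv_srefE; have := ninv_word s; case: ifP => _; lia.
Qed.

Lemma ldes_word i s : reduced (i :: s) -> ldes (word_perm (i :: s)) i.
Proof. by rewrite reduced_cons /= ldes_sref => /andP[]. Qed.

Lemma word_perm_rev s : word_perm (rev s) = ((word_perm s)^-1)%g.
Proof.
elim: s => [|i s IH]; first by rewrite invg1.
by rewrite rev_cons -cats1 word_perm_cat IH /= mul1g invMg srefV.
Qed.

(** * Independence of the reduced word *)

Section Matsumoto.
Context (X : Type) (T : 'I_n -> X -> X).
Hypothesis T_comm : forall i j f, (i.+1 < j)%N -> T i (T j f) = T j (T i f).
Hypothesis T_braid : forall i j f, j = i.+1 :> nat ->
  T i (T j (T i f)) = T j (T i (T j f)).

(** Matsumoto's theorem, by induction on length. If the first letters i and j differ, both are left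
    descents of w, so w also has reduced words beginning with the longest element of the subgroup
    generated by s_i and s_j. The induction hypothesis links [s] and [r] to two such words, and one
    braid or commutation relation links these. *)
Lemma matsumoto s r f : reduced s -> reduced r -> word_perm s = word_perm r ->
  foldr T f s = foldr T f r.
Proof.
move: {2}(size s) (erefl (size s)) => m.
elim/ltn_ind: m s r => m IH s r sm rs rr sr.
have rm : size r = m by rewrite -sm (eqP rs) (eqP rr) sr.
case: s sm rs sr => [|i s] sm rs sr.
  by case: r rm rr sr => // j r; rewrite -sm.
case: r rm rr sr => [|j r] rm rr sr; first by rewrite -sm in rm.
rewrite /= in sm rm.
have rs' : reduced s by move: rs; rewrite reduced_cons => /andP[].
have rr' : reduced r by move: rr; rewrite reduced_cons => /andP[].
have [ij|ne_ij] := eqVneq i j.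
  subst j; rewrite /=; congr T; apply: (IH m.-1); rewrite -?sm //.
  by move: sr => /= /mulIg.
have di := ldes_word rs; have dj := ldes_word rr.
wlog lt_ij : i j s r {ne_ij} sm rs rm rr rs' rr' sr di dj / (i < j)%N.
  move=> W; have [ij|ji|ij] := ltngtP i j; first exact: W.
    by rewrite (W j i r s).
  by rewrite (val_inj ij) eqxx in ne_ij.
set w := word_perm (i :: s) in sr di.
have sw : word_perm s = (w * sref i)%g by rewrite /w /= -mulgA srefK mulg1.
have rw : word_perm r = (w * sref j)%g by rewrite sr /= -mulgA srefK mulg1.
rewrite -sr in dj.
have wm : ninv w = m by rewrite -(eqP rs) /= sm.
clearbody w.
have step (u : seq _) : forall l (v : {perm _}), ldes v l -> word_perm u = (v * sref l)%g -> reduced u ->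
    [/\ word_perm (l :: u) = v, reduced (l :: u) & ninv v = (size u).+1].
  move=> l v dv uv ru; rewrite reduced_cons ru uv ldes_sref dv /=.
  rewrite uv -mulgA srefK mulg1; split=> //.
  by rewrite (ninv_down dv) -uv (eqP ru).
have [jE|ltj] : j = i.+1 :> nat \/ (i.+1 < j)%N by lia.
  have lh : lo j = hi i by apply/val_inj.
  have fixi : sref i (hi j) = hi j.
    by apply: sref_fix; rewrite -val_eqE /= ?/bump /=; lia.
  have fixj : sref j (lo i) = lo i.
    by apply: sref_fix; rewrite -val_eqE /= ?/bump /=; lia.
  have E1 : sref j (hi i) = hi j by rewrite -lh sref_lo.
  have E2 : sref j (hi j) = hi i by rewrite -lh sref_hi.
  have sE := (E1, E2, fixi, fixj, sref_lo i, sref_hi i).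
  have d1 : ldes (w * sref i) j.
    by move: di dj; rewrite /ldes invMg !permM srefV lh !sE => a b; exact: ltn_trans b a.
  have d2 : ldes (w * sref i * sref j) i.
    by move: di dj; rewrite /ldes !invMg !permM !srefV lh !sE.
  have d1' : ldes (w * sref j) i.
    by move: di dj; rewrite /ldes invMg !permM srefV lh !sE => a b; exact: ltn_trans b a.
  have d2' : ldes (w * sref j * sref i) j.
    by move: di dj; rewrite /ldes !invMg !permM !srefV lh !sE.
  have bE : (w * sref i * sref j * sref i = w * sref j * sref i * sref j)%g.
    by rewrite -!mulgA !(mulgA (sref _)) sref_braid.
  (* [u] spells what is left of w once s_i s_j s_i is stripped; prefixing [[:: i; j; i]] or
     [[:: j; i; j]] gives two reduced words of w. *)
  have [u uz uw] := ninv_word_ex (w * sref i * sref j * sref i)%g.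
  have ru : reduced u by rewrite /reduced uz uw.
  have [e1 r1 n1] := step u i _ d2 uw ru.
  have [e2 r2 n2] := step (i :: u) j _ d1 e1 r1.
  have uw' := uw; rewrite bE in uw'.
  have [e1' r1' n1'] := step u j _ d2' uw' ru.
  have [e2' r2' n2'] := step (j :: u) i _ d1' e1' r1'.
  rewrite /= (IH m.-1 _ s (j :: i :: u)) ?e2 //; try by rewrite -sm.
  rewrite (IH m.-1 _ r (i :: j :: u)) ?e2' //; try by rewrite -sm ?rm.
  - exact: T_braid.
  by rewrite -rm.
have fix1 : sref i (lo j) = lo j by apply: sref_fix; rewrite -val_eqE /= ?/bump /=; lia.
have fix2 : sref i (hi j) = hi j by apply: sref_fix; rewrite -val_eqE /= ?/bump /=; lia.
have fix3 : sref j (lo i) = lo i by apply: sref_fix; rewrite -val_eqE /= ?/bump /=; lia.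
have fix4 : sref j (hi i) = hi i by apply: sref_fix; rewrite -val_eqE /= ?/bump /=; lia.
have d1 : ldes (w * sref i) j by rewrite /ldes invMg !permM srefV fix1 fix2.
have d1' : ldes (w * sref j) i by rewrite /ldes invMg !permM srefV fix3 fix4.
have [u uz uw] := ninv_word_ex (w * sref i * sref j)%g.
have ru : reduced u by rewrite /reduced uz uw.
have [e1 r1 n1] := step u j _ d1 uw ru.
have uw' := uw; rewrite -mulgA sref_comm // mulgA in uw'.
have [e1' r1' n1'] := step u i _ d1' uw' ru.
rewrite /= (IH m.-1 _ s (j :: u)) ?e1 //; try by rewrite -sm.
rewrite (IH m.-1 _ r (i :: u)) ?e1' //; try by rewrite -sm ?rm.
- exact: T_comm.
by rewrite -rm.
Qed.

End Matsumoto.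
End Length.

(** * Weights *)

Section Weights.
Context (n : nat).
Implicit Types (i : 'I_n) (a b : 'I_n.+1) (w u v : 'S_n.+1) (lam d : weight n.+1).

Lemma wactM u w lam : wact (u * w)%g lam = wact w (wact u lam).
Proof. by apply/ffunP => a; rewrite !ffunE invMg permM. Qed.

Lemma wact1 lam : wact 1%g lam = lam.
Proof. by apply/ffunP => a; rewrite !ffunE invg1 perm1. Qed.

Lemma wactN w lam : wact w (- lam) = - wact w lam.
Proof. by apply/ffunP => a; rewrite !ffunE. Qed.

Lemma wactK w : cancel (wact w) (wact (w^-1)%g).
Proof. by move=> lam; rewrite -wactM mulgV wact1. Qed.

Definition swap i lam := wact (sref i) lam.

Lemma swap_lo i lam : swap i lam (lo i) = lam (hi i).
Proof. by rewrite ffunE srefV sref_lo. Qed.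

Lemma swap_hi i lam : swap i lam (hi i) = lam (lo i).
Proof. by rewrite ffunE srefV sref_hi. Qed.

Lemma swap_fix i lam a : lo i != a -> hi i != a -> swap i lam a = lam a.
Proof. by move=> ? ?; rewrite ffunE srefV sref_fix. Qed.

Lemma swapK i : involutive (swap i).
Proof. by move=> lam; rewrite /swap -wactM srefK wact1. Qed.

Lemma swap_id i lam : lam (lo i) = lam (hi i) -> swap i lam = lam.
Proof.
move=> E; apply/ffunP => a; have [<-|l] := eqVneq (lo i) a; first by rewrite swap_lo.
by have [<-|h] := eqVneq (hi i) a; [rewrite swap_hi | rewrite swap_fix].
Qed.

Definition dominant lam := forall a b : 'I_n.+1, (a <= b)%N -> lam b <= lam a.

Lemma wplus_dominant lam : dominant (wplus lam).
Proof.
move=> a b ab; rewrite !ffunE.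
have sz : size (sort >=%O (codom lam)) = n.+1.
  by rewrite size_sort size_codom card_ord.
have le := sorted_leq_nth (@ge_trans _ int) (@ge_refl _ int) 0
  (sort_sorted (@ge_total _ int) (codom lam)).
apply: (le a b) => //.
  by rewrite inE sz.
by rewrite inE sz.
Qed.

Lemma wplus_id lam : dominant lam -> wplus lam = lam.
Proof.
move=> dl; have nthE a : nth 0 (codom lam) (nat_of_ord a) = lam a.
  by rewrite codomE (nth_map a) ?size_enum_ord // nth_ord_enum.
have sz : size (codom lam) = n.+1 by rewrite size_codom card_ord.
apply/ffunP => a; rewrite ffunE sorted_sort ?nthE //; first exact: ge_trans.
apply/(sortedP 0) => m; rewrite sz => ltm.
have := nthE (Ordinal ltm); have := nthE (Ordinal (ltnW ltm)) => /= -> ->.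
by apply: (dl (Ordinal (ltnW ltm)) (Ordinal ltm)); exact: leqnSn.
Qed.

Lemma wplus_wact w lam : wplus (wact w lam) = wplus lam.
Proof.
have E : sort >=%O (codom (wact w lam)) = sort >=%O (codom lam).
  apply/perm_sortP; [exact: ge_total | exact: ge_trans | exact: ge_anti |].
  have -> : codom (wact w lam) = map lam (map (w^-1)%g (enum 'I_n.+1)).
    by rewrite codomE -[RHS]map_comp; apply: eq_map => a; rewrite /= ffunE.
  rewrite [codom lam]codomE; apply: perm_map; apply: uniq_perm.
  - by rewrite map_inj_uniq ?enum_uniq //; exact: perm_inj.
  - exact: enum_uniq.
  by move=> a; rewrite mem_enum; apply/mapP; exists (w a); rewrite ?mem_enum ?permK.
by apply/ffunP => a; rewrite !ffunE E.
Qed.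

Lemma ninvV w : ninv (w^-1)%g = ninv w.
Proof.
have le u : (ninv (u^-1)%g <= ninv u)%N.
  have [s <- <-] := ninv_word_ex u; rewrite -word_perm_rev -(size_rev s).
  exact: ninv_word.
by apply/eqP; rewrite eqn_leq le -{1}(invgK w) le.
Qed.

Lemma w0V : ((w0 n.+1)^-1 = w0 n.+1)%g.
Proof.
apply/permP => a; apply: (@perm_inj _ (w0 n.+1)).
by rewrite permKV !permE rev_ordK.
Qed.

Lemma w0K : (w0 n.+1 * w0 n.+1 = 1)%g.
Proof. by rewrite -{1}w0V mulVg. Qed.

Lemma w0_lo i : w0 n.+1 (lo (rev_ord i)) = hi i.
Proof. by rewrite permE; apply/val_inj; rewrite /= /bump /=; have := ltn_ord i; lia. Qed.

Lemma w0_hi i : w0 n.+1 (hi (rev_ord i)) = lo i.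
Proof. by rewrite permE; apply/val_inj; rewrite /= /bump /=; have := ltn_ord i; lia. Qed.

Lemma w0_sref i : (sref i * w0 n.+1 = w0 n.+1 * sref (rev_ord i))%g.
Proof.
have -> : sref (rev_ord i) = (sref i ^ w0 n.+1)%g.
  have El : w0 n.+1 (lo i) = hi (rev_ord i) by rewrite -w0_hi -permM w0K perm1.
  have Eh : w0 n.+1 (hi i) = lo (rev_ord i) by rewrite -w0_lo -permM w0K perm1.
  by rewrite [sref i]srefE tpermJ srefE El Eh tpermC.
by rewrite conjgE w0V !mulgA w0K mul1g.
Qed.

Lemma perm_Inv_w0M w :
  perm_Inv (w * w0 n.+1)%g = [set ab : 'I_n.+1 * 'I_n.+1 | (ab.1 < ab.2)%N & (w ab.1 < w ab.2)%N].
Proof.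
apply/setP => -[a b]; rewrite !inE /= !permM !permE /=.
by case: (ltnP a b) => //= _; have := ltn_ord (w a); have := ltn_ord (w b); lia.
Qed.

(** Each pair is an inversion of exactly one of [w] and w0 o w. This additivity is what lets T_w0
    factor through any T_tau. *)
Lemma ninv_w0M w : (ninv w + ninv (w * w0 n.+1) = ninv (w0 n.+1))%N.
Proof.
have -> : ninv (w0 n.+1) = #|perm_Inv w :|: perm_Inv (w * w0 n.+1)%g|.
  rewrite /ninv -[w0 n.+1]mul1g perm_Inv_w0M mul1g perm_Inv_w0M; apply: eq_card => -[a b].
  rewrite !inE /= !perm1; case: (ltnP a b) => //= ab.
  by case: (ltngtP (w a) (w b)) => // /val_inj/perm_inj E; rewrite E ltnn in ab.
rewrite cardsU [X in (_ - X)%N](_ : _ = 0%N) ?subn0 //.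
rewrite perm_Inv_w0M; apply/eqP; rewrite cards_eq0; apply/eqP/setP => -[a b]; rewrite !inE /=.
by case: (ltngtP (w a) (w b)) => //; rewrite ?andbF.
Qed.

Lemma eps_Inv_dominant d : dominant d -> #|eps_Inv d| = ninv (w0 n.+1).
Proof.
move=> dd; rewrite /ninv -[w0 n.+1]mul1g perm_Inv_w0M; apply: eq_card => -[a b].
rewrite !inE /= !perm1; case: (ltnP a b) => //= ab.
by rewrite dd // ltnW.
Qed.

(** Applying s_i to both entries matches the pairs other than (i, i + 1); that one pair accounts for
    the difference. *)
Lemma eps_Inv_swap i lam : lam (hi i) < lam (lo i) ->
  #|eps_Inv lam| = #|eps_Inv (swap i lam)|.+1.
Proof.
move=> lt; pose f (ab : 'I_n.+1 * 'I_n.+1) := (sref i ab.1, sref i ab.2).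
have fK : involutive f by move=> [a b]; rewrite /f /= -!permM srefK !perm1.
rewrite (cardsD1 (lo i, hi i)) inE /= ltnSn (ltW lt) add1n; congr _.+1.
rewrite -(card_imset _ (inv_inj fK)); apply: eq_card => -[a b].
apply/imsetP/idP => [[[c e]]|].
  rewrite !inE /= => /and3P[ne ce le] [-> ->].
  by rewrite sref_lt //= !ffunE srefV -!permM srefK !perm1.
rewrite !inE /= => /andP[ab le]; exists (f (a, b)); last by rewrite fK.
have ne : (a, b) != (lo i, hi i).
  by apply/eqP => -[Ea Eb]; move: le; rewrite Ea Eb swap_lo swap_hi leNgt lt.
rewrite !inE /= sref_lt //=; apply/andP; split.
  apply/eqP => /(congr1 f); rewrite fK => -[Ea Eb].
  by move: ab; rewrite Ea Eb sref_lo sref_hi ltnNge leqnSn.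
by move: le; rewrite !ffunE srefV.
Qed.

(* Send each pair to its image under w0 o w: pairs inverted by w keep their
   orientation, the others are reversed. *)
Lemma eps_Inv_split w lam :
  (#|perm_Inv w :&: eps_Inv lam| + #|perm_Inv (w * w0 n.+1)%g :&: eps_Inv (- lam)|)%N
  = #|eps_Inv (wact (w * w0 n.+1)%g lam)|.
Proof.
pose r := (w * w0 n.+1)%g.
pose A1 := perm_Inv w :&: eps_Inv lam.
pose A2 := perm_Inv r :&: eps_Inv (- lam).
have rlt a b : (r a < r b)%N = (w b < w a)%N.
  by rewrite !permM !permE /=; have := ltn_ord (w a); have := ltn_ord (w b); lia.
pose f (ab : 'I_n.+1 * 'I_n.+1) := (r ab.1, r ab.2).
pose g (ab : 'I_n.+1 * 'I_n.+1) := (r ab.2, r ab.1).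
have fI : injective f by move=> [a b] [c e] [] /perm_inj-> /perm_inj->.
have gI : injective g by move=> [a b] [c e] [] /perm_inj-> /perm_inj->.
rewrite -/A1 -/A2 -[#|A1|](card_imset _ fI) -[#|A2|](card_imset _ gI) -cardsUI.
rewrite [X in (_ + X)%N](_ : _ = 0%N) ?addn0.
  apply: eq_card => -[a b]; rewrite !inE; apply/orP/idP.
    case=> /imsetP[[c e]]; rewrite !inE /= => /andP[/andP[ce we] /andP[_ le]] [-> ->].
      by rewrite /= rlt we !ffunE -/r !permK.
    by rewrite /= we !ffunE -/r !permK; move: le; rewrite !ffunE lerN2.
  rewrite /= !ffunE -/r => /andP[ab le].
  have [c aE] : exists c, a = r c by exists (r^-1%g a); rewrite permKV.
  have [e bE] : exists e, b = r e by exists (r^-1%g b); rewrite permKV.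
  subst a b; move: le; rewrite !permK => le.
  have [ce|ec|E] := ltngtP c e.
  - left; apply/imsetP; exists (c, e) => //; rewrite !inE /= ce le -rlt.
    by move: ab => /= ->.
  - right; apply/imsetP; exists (e, c) => //; rewrite !inE /= ec ab /=.
    by rewrite !ffunE lerN2.
  by rewrite (val_inj E) ltnn in ab.
apply/eqP; rewrite cards_eq0; apply/eqP/setP => -[a b]; rewrite !inE.
apply/andP => -[/imsetP[[c e] cA [-> ->]] /imsetP[[c' e'] cA' [/perm_inj E1 /perm_inj E2]]].
by move: cA cA'; rewrite -E1 -E2 !inE /=; lia.
Qed.

End Weights.

(** * Recursions for nonsymmetric Hall-Littlewood polynomials *)

Section HeckeAction.
Context (k : fieldType) (n : nat) (p : k).
Hypothesis p_neq0 : p != 0.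
Local Notation K := (ratfun k n.+1).
Local Notation T := (@DLop k n p).
Local Notation Tw := (@DLperm k n p).
Local Notation E := (@nsE k n p).
Local Notation P := (rC n.+1 p).
Implicit Types (i : 'I_n) (w u v : 'S_n.+1) (lam d : weight n.+1) (f g : K).

Lemma rC_neq0 : P != 0.
Proof. by rewrite fmorph_eq0. Qed.

Let quad_inv (L : fieldType) (c t f : L) : c != 0 ->
  c^-1 * ((c - 1) * t + c * f + (1 - c) * t) = f.
Proof. by move=> nc; field. Qed.

(** T_i^-1, solved from the quadratic relation T^2 = (p - 1) T + p. *)
Definition DLinv i f : K := P^-1 * (T i f + (1 - P) * f).

Lemma DLinvK i f : T i (DLinv i f) = f.
Proof.
rewrite /DLinv -fmorphV DLopZ raddfD /= -(rmorph1 (@rC k n.+1)) -rmorphB /= DLopZ DLop_quad.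
rewrite rmorphB rmorph1 fmorphV; exact: quad_inv rC_neq0.
Qed.

Lemma DLopK i f : DLinv i (T i f) = f.
Proof. by rewrite /DLinv DLop_quad; exact: quad_inv rC_neq0. Qed.

Lemma DLop_inj i : injective (T i).
Proof. exact: can_inj (DLopK i). Qed.

Lemma DLwordZ s c f : foldr T (rC _ c * f) s = rC _ c * foldr T f s.
Proof. by elim: s => //= i s ->; rewrite DLopZ. Qed.

Lemma DLpermZ w c f : Tw w (rC _ c * f) = rC _ c * Tw w f.
Proof. exact: DLwordZ. Qed.

Lemma DLword_inj s : injective (fun f => foldr T f s).
Proof. by elim: s => [|i s IH] f g //= /DLop_inj/IH. Qed.

Lemma DLword_surj s f : exists g, foldr T g s = f.
Proof.
elim: s f => [|i s IH] f; first by exists f.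
by have [g gE] := IH (DLinv i f); exists g; rewrite /= gE DLinvK.
Qed.

Lemma DLperm_invK w f : Tw w (DLperm_inv p w f) = f.
Proof.
apply: (epsilon_spec (inhabits 0) (fun g => Tw w g = f)).
exact: DLword_surj.
Qed.

(** Injectivity of T_w pins down the choice made by [epsilon]. *)
Lemma DLperm_inv_eq w f g : Tw w g = f -> DLperm_inv p w f = g.
Proof. by move=> gE; apply: (@DLword_inj (reduced_word w)); rewrite -/(Tw w _) DLperm_invK. Qed.

Lemma DLperm_word s f : reduced s -> Tw (word_perm s) f = foldr T f s.
Proof.
move=> rs; have [rw rr] := reduced_wordP (word_perm s).
exact: (matsumoto (T := DLop p) (@DLop_comm k n p) (@DLop_braid k n p) f rr rs rw).
Qed.

Lemma DLpermL w i f : ~~ ldes w i -> Tw (w * sref i)%g f = T i (Tw w f).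
Proof.
move=> nd; have [rw rr] := reduced_wordP w.
have -> : (w * sref i)%g = word_perm (i :: reduced_word w) by rewrite /= rw.
by rewrite DLperm_word ?reduced_cons ?rr ?rw.
Qed.

Lemma DLpermR w i f : ~~ ldes (w^-1)%g i -> Tw (sref i * w)%g f = Tw w (T i f).
Proof.
move=> nd; have [rw rr] := reduced_wordP w.
have E1 : word_perm (reduced_word w ++ [:: i]) = (sref i * w)%g.
  by rewrite word_perm_cat /= mul1g rw.
rewrite -E1 DLperm_word ?foldr_cat // /reduced E1 size_cat /= addn1.
rewrite -ninvV invMg srefV ninv_up // ninvV; move/eqP: rr => ->.
by rewrite rw.
Qed.

Lemma ract_xmon w lam : ract w (xmon k lam) = xmon k (wact w lam).
Proof.
rewrite rmorph_prod /= [RHS](reindex_inj (@perm_inj _ w)); apply: eq_bigr => a _.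
by rewrite ffunE permK fmorphXz /= ract_rX.
Qed.

Lemma DLop_eq i lam : lam (lo i) = lam (hi i) -> T i (xmon k lam) = P * xmon k lam.
Proof.
by move=> eq; rewrite DLopE ract_xmon [wact _ _](swap_id eq) /dl subrr mulr0 addr0.
Qed.

(** The formula for E with the dominant weight and the permutation left free. Once it is known to
    depend on [w] only through the weight reached, any convenient permutation may replace the one
    chosen in [nsE]. *)
Definition nsEw d w : K := P ^- ninv w * Tw w (xmon k d).

Lemma nsEwR d w i : d (lo i) = d (hi i) -> nsEw d (sref i * w)%g = nsEw d w.
Proof.
have up u : d (lo i) = d (hi i) -> ~~ ldes (u^-1)%g i -> nsEw d (sref i * u)%g = nsEw d u.
  move=> eq nd; rewrite /nsEw DLpermR // DLop_eq // DLpermZ mulrA; congr (_ * _).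
  rewrite -[ninv (_ * u)]ninvV invMg srefV ninv_up // ninvV exprS invfM mulrAC mulVf ?mul1r //.
  exact: rC_neq0.
move=> eq; have [nd|nd] := boolP (ldes (w^-1)%g i); last exact: up.
have := up (sref i * w)%g eq; rewrite mulgA srefK mul1g => -> //.
by rewrite invMg srefV ldes_sref nd.
Qed.

(* The stabilizer of a dominant weight is generated by the simple reflections
   it contains. *)
Lemma nsEw_stab d v w : dominant d -> wact v d = d -> nsEw d (v * w)%g = nsEw d w.
Proof.
move=> dd; move: {2}(ninv v) (erefl (ninv v)) => m.
elim: m v w => [|m IH] v w vm vd.
  have [->|/ldes_ex[i /ninv_down]] := eqVneq v 1%g; last by rewrite vm.
  by rewrite mul1g.
have [Ev|/ldes_ex[i di]] := eqVneq v 1%g; first by rewrite Ev mul1g.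
have eq : d (lo i) = d (hi i).
  apply/eqP; rewrite eq_le [X in _ && X]dd ?leqnSn // andbT.
  have -> : d (lo i) = d ((v^-1)%g (lo i)) by rewrite -{1}vd ffunE.
  have -> : d (hi i) = d ((v^-1)%g (hi i)) by rewrite -{1}vd ffunE.
  by apply: dd; apply: ltnW.
rewrite -(nsEwR w eq).
have -> : (v * w = v * sref i * (sref i * w))%g.
  by rewrite -mulgA (mulgA (sref i)) srefK mul1g.
apply: IH; first by have := ninv_down di; lia.
by rewrite wactM vd [wact _ _](swap_id eq).
Qed.

Lemma nsE_dominant d w lam : dominant d -> wact w d = lam -> E lam = nsEw d w.
Proof.
move=> dd wd; rewrite /nsE; set u := xchoose _.
have /eqP uE : wact u (wplus lam) == lam := xchooseP (wplus_ex lam).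
have dE : wplus lam = d by rewrite -wd wplus_wact wplus_id.
rewrite dE ell_ninv -/(nsEw d u); rewrite dE in uE.
rewrite -[u in LHS](mulgKV w) nsEw_stab // wactM uE -wd.
exact: wactK.
Qed.

Lemma nsE_orbit lam : exists2 w, wact w (wplus lam) = lam & E lam = nsEw (wplus lam) w.
Proof.
have /eqP uE := xchooseP (wplus_ex lam); exists (xchoose (wplus_ex lam)) => //.
by apply: nsE_dominant => //; exact: wplus_dominant.
Qed.

Lemma nsE_swap i lam : lam (hi i) < lam (lo i) ->
  T i (E lam) = P * E (swap i lam).
Proof.
move=> lt; have [w wd wE] := nsE_orbit lam; set d := wplus lam in wd wE.
have dd : dominant d by exact: wplus_dominant.
have nd : ~~ ldes w i.
  have dE a : lam a = d ((w^-1)%g a) by rewrite -{1}wd ffunE.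
  by apply: contraL lt => /ltnW le; rewrite -leNgt !dE; exact: dd.
rewrite wE (@nsE_dominant d (w * sref i)%g) // ?wactM ?wd // /nsEw ninv_up //.
rewrite DLpermL // -exprVn -fmorphV -rmorphXn DLopZ rmorphXn fmorphV /=.
by rewrite exprS invfM mulrA mulrA divff ?mul1r ?exprVn // rC_neq0.
Qed.

Lemma nsE_eq i lam : lam (lo i) = lam (hi i) -> T i (E lam) = P * E lam.
Proof.
move=> eq; have [w wd wE] := nsE_orbit lam; set d := wplus lam in wd wE.
have dd : dominant d by exact: wplus_dominant.
(* [u] and its product with s_i both carry d to [lam], so E may be computed from either; the longer
   one contributes T_i and one more factor P^-1. *)
have up u : ~~ ldes u i -> wact u d = lam -> T i (E lam) = P * E lam.
  move=> nd ud; rewrite {2}(@nsE_dominant d (u * sref i)%g) //; last first.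
    by rewrite wactM ud [wact _ _]swap_id.
  rewrite (@nsE_dominant d u) // /nsEw ninv_up //.
  rewrite DLpermL // -exprVn -fmorphV -rmorphXn DLopZ rmorphXn fmorphV /=.
  by rewrite exprS invfM mulrA mulrA divff ?mul1r ?exprVn // rC_neq0.
have [nd|nd] := boolP (ldes w i); last exact: up nd wd.
apply: (up (w * sref i)%g); first by rewrite ldes_sref nd.
by rewrite wactM wd [wact _ _]swap_id.
Qed.

Lemma DLperm1 f : Tw 1%g f = f.
Proof. by rewrite -[1%g]/(word_perm [::]) DLperm_word // /reduced ninv1. Qed.

Lemma nsE_mon d : dominant d -> E d = xmon k d.
Proof.
move=> dd; rewrite (@nsE_dominant d 1%g) ?wact1 // /nsEw ninv1 DLperm1.
by rewrite expr0 invr1 mul1r.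
Qed.

Lemma ldes_w0 i : ldes (w0 n.+1) i.
Proof.
rewrite /ldes w0V !permE /= /bump /=; have := ltn_ord i; lia.
Qed.

(** With i' the mirror of i, w0 = s_i' u = u s_i, and both factorisations are reduced. Hence T_w0
    T_i = T_i' T_u T_i = T_i' T_w0. *)
Lemma DLperm_w0_comm i f : Tw (w0 n.+1) (T i f) = T (rev_ord i) (Tw (w0 n.+1) f).
Proof.
pose u := (w0 n.+1 * sref (rev_ord i))%g.
have uR : (u * sref (rev_ord i) = w0 n.+1)%g by rewrite -mulgA srefK mulg1.
have uL : (sref i * u = w0 n.+1)%g by rewrite /u -w0_sref mulgA srefK mul1g.
have nd : ~~ ldes u (rev_ord i) by rewrite ldes_sref ldes_w0.
rewrite -{1}uR DLpermL // -[Tw u _]DLpermR ?uL //.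
by rewrite /u -w0_sref invMg srefV w0V ldes_sref ldes_w0.
Qed.

(** This is E^sigma for sigma = w0: all pairs are inversions of w0, so the exponent counts the whole
    of [eps_Inv lam]. *)
Definition nsH lam : K :=
  P ^+ #|eps_Inv lam| * DLperm_inv p (w0 n.+1) (E (wact (w0 n.+1) lam)).

Lemma DLperm_nsH lam :
  Tw (w0 n.+1) (nsH lam) = P ^+ #|eps_Inv lam| * E (wact (w0 n.+1) lam).
Proof. by rewrite /nsH -rmorphXn DLpermZ DLperm_invK. Qed.

Lemma DLperm_inj w : injective (Tw w).
Proof. exact: DLword_inj. Qed.

Lemma wact_w0_swap i lam :
  wact (w0 n.+1) (swap i lam) = swap (rev_ord i) (wact (w0 n.+1) lam).
Proof. by rewrite /swap -!wactM w0_sref. Qed.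

Lemma wact_w0_lo i lam : wact (w0 n.+1) lam (lo (rev_ord i)) = lam (hi i).
Proof. by rewrite ffunE w0V w0_lo. Qed.

Lemma wact_w0_hi i lam : wact (w0 n.+1) lam (hi (rev_ord i)) = lam (lo i).
Proof. by rewrite ffunE w0V w0_hi. Qed.

(** T_w0 carries this to [nsE_swap] at the mirror index; the factor P found there is absorbed by the
    change of [eps_Inv]. *)
Lemma nsH_swap i lam : lam (hi i) < lam (lo i) -> T i (nsH (swap i lam)) = nsH lam.
Proof.
move=> lt; apply: (@DLperm_inj (w0 n.+1)); rewrite DLperm_w0_comm !DLperm_nsH.
rewrite -rmorphXn DLopZ rmorphXn /= nsE_swap; last first.
  by rewrite wact_w0_lo wact_w0_hi swap_lo swap_hi.
by rewrite wact_w0_swap swapK (eps_Inv_swap lt) exprSr mulrA.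
Qed.

Lemma nsH_eq i lam : lam (lo i) = lam (hi i) -> T i (nsH lam) = P * nsH lam.
Proof.
move=> eq; apply: (@DLperm_inj (w0 n.+1)); rewrite DLperm_w0_comm DLpermZ.
rewrite !DLperm_nsH -rmorphXn DLopZ /= nsE_eq; last by rewrite wact_w0_lo wact_w0_hi.
exact: mulrCA.
Qed.

Lemma nsH_mon d : dominant d -> nsH d = xmon k d.
Proof.
move=> dd; apply: (@DLperm_inj (w0 n.+1)); rewrite DLperm_nsH.
rewrite (@nsE_dominant d (w0 n.+1)) // /nsEw eps_Inv_dominant // mulrA divff ?mul1r //.
by rewrite expf_neq0 // rC_neq0.
Qed.

End HeckeAction.

(** * Norm and dominance order on weights *)

Section WeightGeometry.
Context (n : nat).
Implicit Types (i : 'I_n) (a b c : weight n.+1).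

Definition dotw a b : int := \sum_x a x * b x.
Definition nrm a : int := dotw a a.

Lemma dotwNl a b : dotw (- a) b = - dotw a b.
Proof. by rewrite /dotw -sumrN; apply: eq_bigr => x _; rewrite ffunE mulNr. Qed.

Lemma dotwC a b : dotw a b = dotw b a.
Proof. by apply: eq_bigr => x _; rewrite mulrC. Qed.

Lemma nrmN a : nrm (- a) = nrm a.
Proof. by rewrite /nrm dotwNl dotwC dotwNl opprK. Qed.

Lemma nrm_wact w a : nrm (wact w a) = nrm a.
Proof.
rewrite /nrm /dotw (reindex_inj (@perm_inj _ w)); apply: eq_bigr => x _.
by rewrite !ffunE permK.
Qed.

Lemma nrm_swap i a : nrm (swap i a) = nrm a.
Proof. exact: nrm_wact. Qed.

(** For m = a_i - a_(i+1) >= 0 and r = 0, ..., m these weights run along the string from a to s_i a,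
    and their monomials are those that can occur in T_i x^a. *)
Definition down i (r : nat) a : weight n.+1 :=
  [ffun x => a x - (x == lo i)%:R * r%:Z + (x == hi i)%:R * r%:Z].

Lemma down_lo i r a : down i r a (lo i) = a (lo i) - r%:Z.
Proof. by rewrite ffunE eqxx (negPf (lo_neq_hi i)) mul1r mul0r addr0. Qed.

Lemma down_hi i r a : down i r a (hi i) = a (hi i) + r%:Z.
Proof. by rewrite ffunE eqxx eq_sym (negPf (lo_neq_hi i)) mul1r mul0r subr0. Qed.

Lemma down_fix i r a x : lo i != x -> hi i != x -> down i r a x = a x.
Proof.
rewrite ![_ == x]eq_sym => /negPf nl /negPf nh.
by rewrite ffunE nl nh !mul0r subr0 addr0.
Qed.

Lemma big_lo_hi (R : zmodType) i (F : 'I_n.+1 -> R) :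
  \sum_x F x = F (lo i) + (F (hi i) + \sum_(x | (x != lo i) && (x != hi i)) F x).
Proof.
by rewrite (bigD1 (lo i)) //= (bigD1 (hi i)) //= eq_sym lo_neq_hi.
Qed.

Lemma down_swap i a (m : nat) : a (lo i) = a (hi i) + m%:Z -> down i m a = swap i a.
Proof.
move=> E; apply/ffunP => x; have [<-|l] := eqVneq (lo i) x.
  by rewrite down_lo swap_lo E addrK.
have [<-|h] := eqVneq (hi i) x; first by rewrite down_hi swap_hi E.
by rewrite down_fix // swap_fix.
Qed.

Lemma nrm_down i a (r m : nat) : a (lo i) = a (hi i) + m%:Z ->
  (0 < r < m)%N -> nrm (down i r a) < nrm a.
Proof.
move=> E rm; rewrite /nrm /dotw !(big_lo_hi i) down_lo down_hi E.
rewrite [X in _ + (_ + X) < _](eq_bigr (fun x => a x * a x)); last first.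
  by move=> x /andP[l h]; rewrite down_fix // eq_sym.
rewrite -subr_gt0; set S := \sum_(_ | _) _; set h := a (hi i).
have -> : (h + m%:Z) * (h + m%:Z) + (h * h + S)
    - ((h + m%:Z - r%:Z) * (h + m%:Z - r%:Z) + ((h + r%:Z) * (h + r%:Z) + S))
    = 2 * (r%:Z * (m%:Z - r%:Z)) by ring.
by rewrite !mulr_gt0 // ?subr_gt0 ?ltz_nat; case/andP: rm.
Qed.

(* The dominance order, tested against all dominant weights; this makes it
   manifestly additive. *)
Definition domge a b := forall c, dominant c -> dotw c b <= dotw c a.

Lemma domge_refl a : domge a a.
Proof. by move=> c _. Qed.

Lemma domge_trans b a c : domge a b -> domge b c -> domge a c.
Proof. by move=> ab bc e de; exact: le_trans (bc e de) (ab e de). Qed.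

Lemma dotw_sqr a b : nrm (a - b) = nrm a - dotw b a - dotw b a + nrm b.
Proof.
rewrite /nrm /dotw -!sumrB -big_split; apply: eq_bigr => x _ /=.
by rewrite !ffunE; ring.
Qed.

Lemma nrm_ge0 a : 0 <= nrm a.
Proof. by apply: sumr_ge0 => x _; rewrite -expr2 sqr_ge0. Qed.

Lemma nrm_eq0 a : nrm a = 0 -> a = 0.
Proof.
move/eqP; rewrite psumr_eq0 => [/allP a0|x _]; last by rewrite -expr2 sqr_ge0.
apply/ffunP => x; rewrite ffunE; apply/eqP.
by have := a0 x (mem_index_enum x); rewrite mulf_eq0 orbb.
Qed.

Lemma nrm_le_dot a b : nrm b <= dotw b a -> nrm b <= nrm a /\ (nrm b = nrm a -> a = b).
Proof.
move=> le; have := dotw_sqr a b; have := nrm_ge0 (a - b) => ge0 E; split; first by lia.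
move=> eq; have /nrm_eq0 ab0 : nrm (a - b) = 0 by lia.
by apply/eqP; rewrite -subr_eq0 ab0.
Qed.

(** A dominant [b] may itself serve as test weight, giving |b|^2 <= (b, a); then |a - b|^2 >= 0
    yields both claims. In the antidominant case the test weight is -a. *)
Lemma domge_dominant a b : dominant b -> domge a b ->
  nrm b <= nrm a /\ (nrm b = nrm a -> a = b).
Proof. by move=> db ab; exact/nrm_le_dot/ab. Qed.

Lemma domge_antidominant a b : dominant (- a) -> domge a b ->
  nrm a <= nrm b /\ (nrm a = nrm b -> b = a).
Proof.
by move=> da ab; apply/nrm_le_dot; have := ab _ da; rewrite !dotwNl lerN2.
Qed.

Lemma dominantP a : (forall i, a (hi i) <= a (lo i)) -> dominant a.
Proof.
move=> st x [y hy] /=; elim: y hy => [|y IH] hy xy.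
  by have -> : x = Ordinal hy by apply/val_inj => /=; lia.
have [E|ne] := eqVneq (nat_of_ord x) y.+1.
  by have -> : x = Ordinal hy by apply/val_inj.
have hy' : (y < n)%N by [].
have lE : lo (Ordinal hy') = Ordinal (ltnW hy) by apply/val_inj.
have hE : hi (Ordinal hy') = Ordinal hy by apply/val_inj.
have := st (Ordinal hy'); rewrite lE hE => /le_trans; apply; apply: IH.
by move: ne xy; lia.
Qed.

Lemma orbit_ind (Q : weight n.+1 -> Prop) :
    (forall a, dominant a -> Q a) ->
    (forall a i, a (hi i) < a (lo i) -> Q a -> Q (swap i a)) ->
  forall a, Q a.
Proof.
move=> Qd Qs a.
have bnd (b : weight n.+1) : (#|eps_Inv b| <= #|{: 'I_n.+1 * 'I_n.+1}|)%N by exact: max_card.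
(* Induction on the number of pairs outside [eps_Inv a]: exchanging an ascent of [a] adds one pair
   to [eps_Inv], until [a] is dominant. *)
have [m] := ubnP (#|{: 'I_n.+1 * 'I_n.+1}| - #|eps_Inv a|)%N.
elim: m a => // m IH a am.
have [/forallP st|/forallPn[i]] := boolP [forall i, a (hi i) <= a (lo i)].
  exact/Qd/dominantP.
rewrite -ltNge => lt; rewrite -(swapK i a); apply: Qs.
  by rewrite swap_lo swap_hi.
have lt' : swap i a (hi i) < swap i a (lo i) by rewrite swap_lo swap_hi.
apply: IH; have := eps_Inv_swap lt'; rewrite swapK => E; have := bnd (swap i a); rewrite E; lia.
Qed.

Lemma swapN i a : swap i (- a) = - swap i a.
Proof. exact: wactN. Qed.

Lemma orbit_ind_anti (Q : weight n.+1 -> Prop) :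
    (forall a, dominant (- a) -> Q a) ->
    (forall a i, a (lo i) < a (hi i) -> Q a -> Q (swap i a)) ->
  forall a, Q a.
Proof.
move=> Qd Qs a; rewrite -[a]opprK; elim/orbit_ind: (- a) => [b db|b i lt IH].
  by apply: Qd; rewrite opprK.
by rewrite -swapN; apply: Qs => //; rewrite !ffunE ltrN2.
Qed.

End WeightGeometry.

(** * Demazure-Lusztig operators on monomials *)

Section MonomialAction.
Context (k : fieldType) (n : nat) (p : k).
Local Notation K := (ratfun k n.+1).
Local Notation T := (@DLop k n p).
Local Notation P := (rC n.+1 p).
Implicit Types (i : 'I_n) (lam : weight n.+1).

Lemma xmon_split i lam :
  xmon k lam = rX k (lo i) ^ lam (lo i) * (rX k (hi i) ^ lam (hi i)
               * \prod_(x | (x != lo i) && (x != hi i)) rX k x ^ lam x).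
Proof.
by rewrite /xmon (bigD1 (lo i)) //= (bigD1 (hi i)) //= eq_sym lo_neq_hi.
Qed.

Lemma xmon_down i r lam :
  xmon k (down i r lam) = (rX k (hi i) / rX k (lo i)) ^+ r * xmon k lam.
Proof.
rewrite !(xmon_split i).
rewrite [X in _ * (_ * X) = _](eq_bigr (fun x => rX k x ^ lam x)); last first.
  by move=> x /andP[l h]; rewrite down_fix // eq_sym.
rewrite down_lo down_hi !expfzDr ?rX_neq0 // exprMn exprVn -invr_expz.
have gen (L : fieldType) (x y c e z : L) :
    x * c * (y * e * z) = e * c * (x * (y * z)) by ring.
exact: gen.
Qed.

(** With u = x_(i+1) / x_i one has x^(s_i lam) = u^m x^lam, and a geometric sum in u cancels the
    denominator 1 - u. The sum starts at r = 0, that is at x^lam itself; in the opposite case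
    [DLop_lt] it runs over the interior of the string only. *)
Lemma DLop_gt i lam m : lam (lo i) = lam (hi i) + m%:Z ->
  T i (xmon k lam) = P * xmon k (swap i lam)
                     + (P - 1) * \sum_(r < m) xmon k (down i r lam).
Proof.
move=> E; rewrite DLopE ract_xmon -/(swap i lam) -(down_swap E) /dl; congr (_ + _).
under eq_bigr do rewrite xmon_down.
rewrite xmon_down -mulr_suml; set u := rX k (hi i) / rX k (lo i).
have nu : 1 - u != 0.
  have nx := rX_neq0 k (lo i).
  rewrite subr_eq0; apply/eqP => E1; have := divfK nx (rX k (hi i)).
  by rewrite -/u -E1 mul1r => /rX_inj/eqP; rewrite (negPf (lo_neq_hi i)).
have -> : u ^+ m * xmon k lam - xmon k lam
   = - ((1 - u) * (\sum_(r < m) u ^+ r)) * xmon k lam.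
  by rewrite -mulNr opprB -subrX1 mulrBl mul1r.
rewrite -/u; set S := \sum_(r < m) _; set f := xmon k lam.
have gen (L : fieldType) (c v s g : L) : 1 - v != 0 ->
    (1 - c) * (1 / (1 - v)) * (- ((1 - v) * s) * g) = (c - 1) * (s * g).
  by move=> nv; field.
exact: gen.
Qed.

Lemma DLop_lt i lam m : lam (hi i) = lam (lo i) + m.+1%:Z ->
  T i (xmon k lam) = xmon k (swap i lam)
     + (1 - P) * \sum_(r < m) xmon k (down i r.+1 (swap i lam)).
Proof.
move=> E; set mu := swap i lam.
have E' : mu (lo i) = mu (hi i) + m.+1%:Z by rewrite swap_lo swap_hi.
have lamE : lam = down i m.+1 mu by rewrite (down_swap E') swapK.
rewrite DLopE ract_xmon -/(swap i lam) -/mu {1}lamE /dl.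
under eq_bigr do rewrite xmon_down.
rewrite xmon_down -mulr_suml; set u := rX k (hi i) / rX k (lo i).
have nu : 1 - u != 0.
  have nx := rX_neq0 k (lo i).
  rewrite subr_eq0; apply/eqP => E1; have := divfK nx (rX k (hi i)).
  by rewrite -/u -E1 mul1r => /rX_inj/eqP; rewrite (negPf (lo_neq_hi i)).
have -> : xmon k mu - u ^+ m.+1 * xmon k mu
   = (1 - u) * (1 + \sum_(r < m) u ^+ r.+1) * xmon k mu.
  have := subrX1 u m.+1; rewrite big_ord_recl /= expr0 => Eu.
  rewrite -[1 - u]opprB mulNr -Eu mulNr mulrBl mul1r opprB //.
rewrite -/u; set S := \sum_(r < m) _; set f := xmon k mu.
have gen (L : fieldType) (c v s g : L) : 1 - v != 0 ->
    c * g + (1 - c) * (1 / (1 - v)) * ((1 - v) * (1 + s) * g) = g + (1 - c) * (s * g).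
  by move=> nv; field.
exact: gen.
Qed.

End MonomialAction.

(** * Matrices of the Demazure-Lusztig operators *)

Section MatrixAction.
Context (k : fieldType) (n : nat) (p : k).
Hypothesis p_neq0 : p != 0.
Local Notation K := (ratfun k n.+1).
Local Notation T := (@DLop k n p).
Local Notation P := (rC n.+1 p).
Context (N : nat) (W : 'I_N -> weight n.+1).
Hypothesis W_inj : injective W.
Hypothesis W_wact : forall w j, wact w (W j) \in codom W.
Hypothesis W_down : forall i j (r m : nat), W j (lo i) = W j (hi i) + m%:Z ->
  (r <= m)%N -> down i r (W j) \in codom W.
Implicit Types (i : 'I_n) (j l : 'I_N) (lam : weight n.+1) (v : 'cV[k]_N).

(** The family [W] is instantiated twice: by the weights of degree d on the x-side, and by their
    negatives on the y-side, where the variables are inverted. *)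
Definition emb v : K := \sum_j rC _ (v j 0) * xmon k (W j).

Fact emb_zmod_morphism : zmod_morphism emb.
Proof.
by move=> u v; rewrite -sumrB; apply: eq_bigr => j _; rewrite !mxE rmorphB mulrBl.
Qed.
HB.instance Definition _ := GRing.isZmodMorphism.Build _ _ emb emb_zmod_morphism.

Lemma embZ c v : emb (c *: v) = rC _ c * emb v.
Proof. by rewrite mulr_sumr; apply: eq_bigr => j _; rewrite mxE rmorphM mulrA. Qed.

Lemma emb_inj : injective emb.
Proof.
apply: raddf_inj => v /(@lmon_indep k n.+1 _ W (fun j => v j 0) (index_enum 'I_N)) E.
apply/colP => j; rewrite mxE; apply: E; rewrite ?mem_index_enum ?index_enum_uniq //.
exact: in2W.
Qed.

Definition ind lam : 'cV[k]_N := \col_j (W j == lam)%:R.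

Lemma ind_W j : ind (W j) = delta_mx j 0.
Proof. by apply/colP => l; rewrite !mxE (inj_eq W_inj) eqxx andbT. Qed.

Lemma emb_delta j : emb (delta_mx j 0) = xmon k (W j).
Proof.
rewrite /emb (bigD1 j) //= mxE !eqxx rmorph1 mul1r big1 ?addr0 // => l lj.
by rewrite mxE (negPf lj) rmorph0 mul0r.
Qed.

Lemma emb_ind lam : lam \in codom W -> emb (ind lam) = xmon k lam.
Proof. by case/codomP => j ->; rewrite ind_W emb_delta. Qed.

(** The coefficients of [DLop_gt] and [DLop_lt]. For m < 0 the predecessor appears because the
    string has |m| - 1 interior points. *)
Definition tcol i lam : 'cV[k]_N :=
  let m := lam (lo i) - lam (hi i) in
  if 0 <= m
  then p *: ind (swap i lam) + (p - 1) *: \sum_(r < absz m) ind (down i r lam)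
  else ind (swap i lam)
       + (1 - p) *: \sum_(r < (absz m).-1) ind (down i r.+1 (swap i lam)).

Definition tmx i : 'M[k]_N := \matrix_(l, j) tcol i (W j) l 0.

Lemma W_swap i j : swap i (W j) \in codom W.
Proof. exact: W_wact. Qed.

Lemma emb_tcol i j : emb (tcol i (W j)) = T i (xmon k (W j)).
Proof.
rewrite /tcol; set m := W j (lo i) - _; case: ifP => [m0|/negbT].
  have E : W j (lo i) = W j (hi i) + (absz m)%:Z by rewrite gez0_abs // /m addrC subrK.
  rewrite (DLop_gt _ E) raddfD /= !embZ rmorphB rmorph1 raddf_sum.
  rewrite emb_ind ?W_swap //; congr (_ + _ * _); apply: eq_bigr => r _.
  by rewrite /= emb_ind // (W_down E) // ltnW.
rewrite -ltNge => m0.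
have E : W j (hi i) = W j (lo i) + (absz m).-1.+1%:Z.
  by rewrite prednK ?absz_gt0 ?lt_eqF // ltz0_abs // /m opprB addrC subrK.
rewrite (DLop_lt _ E) raddfD /= !embZ rmorphB rmorph1 raddf_sum.
rewrite emb_ind ?W_swap //; congr (_ + _ * _); apply: eq_bigr => r _.
have [j' j'E] := codomP (W_swap i j).
rewrite /= j'E emb_ind //; apply: (@W_down i j' r.+1 (absz m).-1.+1).
  by rewrite -j'E swap_lo swap_hi.
by rewrite ltnS ltnW.
Qed.

Lemma emb_tmx i v : emb (tmx i *m v) = T i (emb v).
Proof.
rewrite /emb raddf_sum /=.
under [RHS]eq_bigr do rewrite DLopZ -emb_tcol mulr_sumr.
rewrite exchange_big /=; apply: eq_bigr => l _.
rewrite mxE raddf_sum mulr_suml; apply: eq_bigr => j _ /=.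
by rewrite mxE rmorphM mulrAC mulrC.
Qed.

Lemma tmx_quad i : tmx i *m tmx i = (p - 1) *: tmx i + p%:M.
Proof.
have ext (A B : 'M[k]_N) : (forall v, emb (A *m v) = emb (B *m v)) -> A = B.
  move=> AB; apply/matrixP => a b; have /emb_inj/colP/(_ a) := AB (delta_mx b 0).
  by rewrite -!colE !mxE.
apply: ext => v; rewrite -mulmxA !emb_tmx DLop_quad mulmxDl raddfD /= -scalemxAl embZ.
by rewrite emb_tmx mul_scalar_mx embZ rmorphB rmorph1.
Qed.

Lemma tmx_mulV i : tmx i *m (p^-1 *: (tmx i + (1 - p)%:M)) = 1%:M.
Proof.
rewrite -scalemxAr mulmxDr tmx_quad mul_mx_scalar addrAC -scalerDl.
by rewrite -[1 - p]opprB subrr scale0r add0r scale_scalar_mx mulVf.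
Qed.

Lemma tmx_unit i : tmx i \in unitmx.
Proof. by have [] := mulmx1_unit (tmx_mulV i). Qed.

Lemma tmx_supp i l j : tmx i l j != 0 ->
  [\/ W l = W j, W l = swap i (W j) | nrm (W l) < nrm (W j)].
Proof.
rewrite mxE /tcol; set m := W j (lo i) - _.
have ind_or lam : lam = W j \/ lam = swap i (W j) \/ nrm lam < nrm (W j) ->
    ind lam l 0 != 0 -> [\/ W l = W j, W l = swap i (W j) | nrm (W l) < nrm (W j)].
  move=> H; rewrite mxE; case: (W l =P lam) H => [->|_ _]; last by rewrite eqxx.
  by case=> [->|[->|lt]] _; [constructor 1|constructor 2|constructor 3].
have sum_or q (F : 'I_q -> weight n.+1) :
    (forall r, F r = W j \/ F r = swap i (W j) \/ nrm (F r) < nrm (W j)) ->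
    (\sum_r ind (F r)) l 0 != 0 ->
    [\/ W l = W j, W l = swap i (W j) | nrm (W l) < nrm (W j)].
  move=> HF; rewrite summxE => nz.
  have [|/existsPn all0] := boolP [exists r, ind (F r) l 0 != 0].
    by case/existsP => r; exact: ind_or.
  by move: nz; rewrite big1 ?eqxx // => r _; apply/eqP; have := all0 r; rewrite negbK.
have add_or (x y : 'cV[k]_N) (c e : k) : (c *: x + e *: y) l 0 != 0 ->
    x l 0 != 0 \/ y l 0 != 0.
  rewrite !mxE; have [->|nx] := eqVneq (x l 0) 0; last by left.
  by have [->|ny] := eqVneq (y l 0) 0; [rewrite !mulr0 addr0 eqxx | right].
case: ifP => [m0|/negbT].
  have E : W j (lo i) = W j (hi i) + (absz m)%:Z by rewrite gez0_abs // /m addrC subrK.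
  case/add_or; first by apply: ind_or; right; left.
  apply: sum_or => r; have [r0|r0] := posnP r.
    by left; apply/ffunP => x; rewrite ffunE r0 !mulr0 subr0 addr0.
  by right; right; apply: nrm_down E _; rewrite r0 ltn_ord.
rewrite -ltNge => m0.
have E : swap i (W j) (lo i) = swap i (W j) (hi i) + (absz m).-1.+1%:Z.
  rewrite swap_lo swap_hi.
  by rewrite prednK ?absz_gt0 ?lt_eqF // ltz0_abs // /m opprB addrC subrK.
rewrite -[ind (swap _ _)]scale1r => /add_or[]; first by apply: ind_or; right; left.
apply: sum_or => r; right; right; rewrite -[X in _ < X](nrm_swap i).
by apply: nrm_down E _; rewrite /= ltnS ltn_ord.
Qed.

(** Interior points of the string have strictly smaller norm by [nrm_down], so in rows of norm at
    least that of column j only the two ends survive. *)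
Lemma tmx_gt i l j : W j (hi i) < W j (lo i) -> nrm (W j) <= nrm (W l) ->
  tmx i l j = p * (W l == swap i (W j))%:R + (p - 1) * (l == j)%:R.
Proof.
move=> lt le; rewrite mxE /tcol; set m := W j (lo i) - _.
have m0 : 0 < m by rewrite subr_gt0.
rewrite (ltW m0) !mxE summxE; congr (_ + _ * _).
have E : W j (lo i) = W j (hi i) + (absz m)%:Z by rewrite gtz0_abs // /m addrC subrK.
have [q qE] : exists q, absz m = q.+1 by exists (absz m).-1; rewrite prednK // absz_gt0 gt_eqF.
rewrite qE in E *; rewrite big_ord_recl big1 => [|r _].
  rewrite addr0 mxE; have -> : down i 0%N (W j) = W j.
    by apply/ffunP => x; rewrite ffunE !mulr0 subr0 addr0.
  by rewrite (inj_eq W_inj).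
rewrite mxE; case: eqP => // WE; have : nrm (W l) < nrm (W j).
  by rewrite WE; apply: nrm_down E _; rewrite /= /bump /= add1n ltnS ltn_ord.
by rewrite ltNge le.
Qed.

Definition tword (s : seq 'I_n) : 'M[k]_N := foldr (fun i A => tmx i *m A) 1%:M s.

Lemma emb_tword s v : emb (tword s *m v) = foldr T (emb v) s.
Proof.
elim: s => [|i s IH] /=; first by rewrite mul1mx.
by rewrite -mulmxA emb_tmx IH.
Qed.

Lemma tword_cat s r : tword (s ++ r) = tword s *m tword r.
Proof. by elim: s => [|i s IH] /=; rewrite ?mul1mx // IH mulmxA. Qed.

Lemma tword_unit s : tword s \in unitmx.
Proof. by elim: s => [|i s IH] /=; rewrite ?unitmx1 // unitmx_mul tmx_unit. Qed.

Lemma tword_eq s r : reduced s -> reduced r -> word_perm s = word_perm r ->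
  tword s = tword r.
Proof.
move=> rs rr sr; apply/matrixP => a b.
suff /emb_inj/colP/(_ a) : emb (tword s *m delta_mx b 0) = emb (tword r *m delta_mx b 0).
  by rewrite -!colE !mxE.
rewrite !emb_tword.
exact: (matsumoto (T := DLop p) (@DLop_comm k n p) (@DLop_braid k n p) _ rs rr sr).
Qed.

Lemma nsE_emb lam : lam \in codom W -> exists v, nsE p lam = emb v.
Proof.
case/codomP => j ->; have [w wE ->] := nsE_orbit p_neq0 (W j).
have /codomP[j' jE] : wplus (W j) \in codom W.
  by rewrite -(wactK w (wplus (W j))) wE; exact: W_wact.
exists ((p ^- ninv w) *: (tword (reduced_word w) *m delta_mx j' 0)).
by rewrite embZ emb_tword emb_delta /nsEw jE fmorphV rmorphXn.
Qed.

(** Here the operator inverse chosen by [epsilon] becomes a matrix inverse. *)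
Lemma DLperm_inv_emb w v :
  DLperm_inv p w (emb v) = emb (invmx (tword (reduced_word w)) *m v).
Proof.
apply: DLperm_inv_eq => //; rewrite /DLperm -emb_tword mulmxA mulmxV ?mul1mx //.
exact: tword_unit.
Qed.

End MatrixAction.

(** * Dual bases *)

Section DualBases.
Context (k : fieldType) (n N : nat) (p : k) (wt : 'I_N -> weight n.+1).
Context (t t' : 'I_n -> 'M[k]_N) (h g : 'I_N -> 'cV[k]_N) (M : 'M[k]_N).
Context (rho : weight n.+1) (R : nat).
Implicit Types (i : 'I_n) (j l c : 'I_N) (v : 'cV[k]_N).
Local Notation B := (1%:M - M).

Hypothesis p_neq0 : p != 0.
Hypothesis wt_inj : injective wt.
Hypothesis wt_wact : forall w j, wact w (wt j) \in codom wt.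
Hypothesis t_supp : forall i l j, t i l j != 0 ->
  [\/ wt l = wt j, wt l = swap i (wt j) | nrm (wt l) < nrm (wt j)].
Hypothesis t'_supp : forall i l j, t' i l j != 0 ->
  [\/ wt l = wt j, wt l = swap i (wt j) | nrm (wt l) < nrm (wt j)].
Hypothesis t_gt : forall i l j,
  wt j (hi i) < wt j (lo i) -> nrm (wt j) <= nrm (wt l) ->
  t i l j = p * (wt l == swap i (wt j))%:R + (p - 1) * (l == j)%:R.
Hypothesis t_quad : forall i, t i *m t i = (p - 1) *: t i + p%:M.
Hypothesis h_swap : forall i j l, wt j (hi i) < wt j (lo i) ->
  wt l = swap i (wt j) -> t i *m h l = h j.
Hypothesis h_eq : forall i j, wt j (lo i) = wt j (hi i) -> t i *m h j = p *: h j.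
Hypothesis h_dom : forall j, dominant (wt j) -> h j = delta_mx j 0.
Hypothesis g_swap : forall i j l, wt j (lo i) < wt j (hi i) ->
  wt l = swap i (wt j) -> t' i *m g j = p *: g l.
Hypothesis g_anti : forall j, dominant (- wt j) -> g j = delta_mx j 0.
Hypothesis rho_dom : dominant rho.
Hypothesis rho_bound : forall j, 0 <= dotw rho (wt j) <= R%:Z.
Hypothesis M_upper : forall l j, M l j != 0 ->
  domge (wt l) (wt j) /\ dotw rho (wt j) < dotw rho (wt l).
Hypothesis B_inv : forall i, t i *m B = B *m (t' i)^T.

Let Mp (m : nat) : 'M[k]_N := iter m (mulmx M) 1%:M.

Let Mp_upper m l j : Mp m l j != 0 ->
  domge (wt l) (wt j) /\ dotw rho (wt j) + m%:Z <= dotw rho (wt l).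
Proof.
elim: m l => [|m IH] l /=.
  rewrite mxE; case: (l =P j) => [-> _|_]; last by rewrite eqxx.
  by split; [exact: domge_refl | rewrite addr0].
rewrite mxE => nz; have [|/existsPn all0] := boolP [exists c, M l c * Mp m c j != 0].
  case/existsP => c; rewrite mulf_eq0 negb_or => /andP[/M_upper[d1 r1] /IH[d2 r2]].
  by split; [exact: domge_trans d1 d2 | lia].
by move: nz; rewrite big1 ?eqxx // => c _; apply/eqP; have := all0 c; rewrite negbK.
Qed.

(** The Neumann series of B^-1. It stops at R because each factor of M raises the pairing with [rho]
    by at least one while that pairing stays within [0, R], so M^(R+1) = 0. *)
Let A : 'M[k]_N := \sum_(m < R.+1) Mp m.

Let BA : B *m A = 1%:M.
Proof.
have MR : M *m Mp R = 0.
  rewrite -[LHS]/(Mp R.+1); apply/matrixP => l j; rewrite [RHS]mxE; apply/eqP; apply/negPn/negP => /Mp_upper[_].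
  by have := rho_bound l; have := rho_bound j; lia.
rewrite mulmxBl mul1mx /A mulmx_sumr big_ord_recl [X in _ - X]big_ord_recr /= MR addr0.
rewrite [X in _ - X](eq_bigr (fun m : 'I_R => Mp (lift ord0 m))) ?addrK //.
Qed.

Let AB : A *m B = 1%:M.
Proof. exact: mulmx1C BA. Qed.

Let A_upper l j : A l j != 0 -> domge (wt l) (wt j).
Proof.
rewrite summxE => nz; have [|/existsPn all0] := boolP [exists m : 'I_R.+1, Mp m l j != 0].
  by case/existsP => m /Mp_upper[].
by move: nz; rewrite big1 ?eqxx // => m _; apply/eqP; have := all0 m; rewrite negbK.
Qed.

Let A_diag j : A j j = 1.
Proof.
have /matrixP/(_ j j) := BA; rewrite mulmxBl mul1mx !mxE eqxx => /eqP.
rewrite subr_eq [X in _ + X]big1 ?addr0 => [/eqP->//|c _].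
apply/eqP; apply/negPn/negP; rewrite mulf_eq0 negb_or => /andP[/M_upper[_ lt] /A_upper].
by move/(_ rho rho_dom); rewrite leNgt lt.
Qed.

(** [B_inv] with B moved to the other side: for the pairing v^T A h, the operator [t' i] is adjoint
    to [t i]. *)
Let A_t i : A *m t i = (t' i)^T *m A.
Proof.
by rewrite -[LHS]mulmx1 -BA !mulmxA -[A *m t i *m B]mulmxA B_inv !mulmxA AB mul1mx.
Qed.

Let t_inv i : t i *m (p^-1 *: (t i + (1 - p)%:M)) = 1%:M.
Proof.
rewrite -scalemxAr mulmxDr t_quad mul_mx_scalar addrAC -scalerDl.
by rewrite -[1 - p]opprB subrr scale0r add0r scale_scalar_mx mulVf.
Qed.

Let t_inj i : injective (fun v => t i *m v).
Proof.
move=> u v E; have := congr1 (mulmx (p^-1 *: (t i + (1 - p)%:M))) E.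
by rewrite !mulmxA (mulmx1C (t_inv i)) !mul1mx.
Qed.

Let h_down i j l : wt j (hi i) < wt j (lo i) -> wt l = swap i (wt j) ->
  h l = p^-1 *: (t i *m h j + (1 - p) *: h j).
Proof.
move=> lt E; apply: (@t_inj i); rewrite (h_swap lt E).
rewrite -[(1 - p) *: h j]mul_scalar_mx -mulmxDl scalemxAl mulmxA t_inv mul1mx //.
Qed.

Let index_ind (Q : 'I_N -> Prop) :
    (forall j, dominant (wt j) -> Q j) ->
    (forall j l i, wt j (hi i) < wt j (lo i) -> wt l = swap i (wt j) -> Q j -> Q l) ->
  forall j, Q j.
Proof.
move=> Qd Qs j; move: {2}(wt j) (erefl (wt j)) => a; elim/orbit_ind: a j.
  by move=> a da j E; apply: Qd; rewrite E.
move=> a i lt IH l lE.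
have /codomP[j jE] : a \in codom wt by rewrite -(swapK i a) -lE; exact: wt_wact.
by rewrite jE in lt lE; apply: (Qs j l i) => //; apply: IH.
Qed.

Let index_ind_anti (Q : 'I_N -> Prop) :
    (forall j, dominant (- wt j) -> Q j) ->
    (forall j l i, wt j (lo i) < wt j (hi i) -> wt l = swap i (wt j) -> Q j -> Q l) ->
  forall j, Q j.
Proof.
move=> Qd Qs j; move: {2}(wt j) (erefl (wt j)) => a; elim/orbit_ind_anti: a j.
  by move=> a da j E; apply: Qd; rewrite E.
move=> a i lt IH l lE.
have /codomP[j jE] : a \in codom wt by rewrite -(swapK i a) -lE; exact: wt_wact.
by rewrite jE in lt lE; apply: (Qs j l i) => //; apply: IH.
Qed.

Let nrm_t i l j : t i l j != 0 -> nrm (wt l) <= nrm (wt j).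
Proof. by case/t_supp => [->|->|/ltW//]; rewrite ?nrm_swap. Qed.

Let nrm_t' i l j : t' i l j != 0 -> nrm (wt l) <= nrm (wt j).
Proof. by case/t'_supp => [->|->|/ltW//]; rewrite ?nrm_swap. Qed.

(** Passing from j to s_i j applies T_i^-1 = p^-1 (T_i + 1 - p). In top norm T_i gives p x^(s_i j) +
    (p - 1) x^j, and the term (1 - p) h_j cancels the second summand, so a single leading monomial
    remains. *)
Let h_lead j l : nrm (wt j) <= nrm (wt l) -> h j l 0 = (l == j)%:R.
Proof.
elim/index_ind: j l => [j dj l _|j j' i lt j'E IH l]; first by rewrite h_dom // mxE eqxx andbT.
rewrite j'E nrm_swap => le; rewrite (h_down lt j'E) !mxE IH //.
rewrite (bigD1 j) //= IH // eqxx mulr1 big1 => [|c cj]; last first.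
  apply/eqP; rewrite mulf_eq0 orbC; apply/orP.
  have [t0|/nrm_t le'] := eqVneq (t i l c) 0; first by right.
  by left; rewrite IH ?(negPf cj) // (le_trans le le').
rewrite addr0 t_gt // -j'E (inj_eq wt_inj).
by rewrite -addrA -mulrDl -[1 - p]opprB subrr mul0r addr0 mulrA mulVf // mul1r.
Qed.

(** Induction on [c] with [v] general. For dominant c, column c of A reaches only weights of norm at
    least that of c, where v vanishes; otherwise T_i is moved by adjointness onto v, and [t' i]
    keeps the support of v in norm at most [nu]. *)
Let orth_low (nu : int) v c : (forall l, nu < nrm (wt l) -> v l 0 = 0) ->
  nu < nrm (wt c) -> v^T *m A *m h c = 0.
Proof.
elim/index_ind: c v => [c dc v v0 lt|c c' i lt c'E IH v v0].
  rewrite h_dom // -colE; apply/matrixP => x y; rewrite !mxE big1 // => l _.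
  rewrite !ord1 mxE; have [->|/A_upper] := eqVneq (A l c) 0; first by rewrite mulr0.
  by case/(domge_dominant dc) => le _; rewrite v0 ?mul0r // (lt_le_trans lt le).
rewrite c'E nrm_swap => ltc; rewrite (h_down lt c'E) -scalemxAr mulmxDr -scalemxAr.
rewrite (IH v) // scaler0 addr0 mulmxA -[v^T *m A *m _]mulmxA A_t mulmxA -trmx_mul.
rewrite (IH (t' i *m v)) ?scaler0 // => l ltl; rewrite mxE big1 // => m _.
have [->|/nrm_t' le] := eqVneq (t' i l m) 0; first by rewrite mul0r.
by rewrite v0 ?mulr0 // (lt_le_trans ltl le).
Qed.

(** Only antidominant [a] requires the norms. The remaining [a] follow by moving T_i from g to h,
    since the two recursions have matching coefficients. *)
Let orth a c : (g a)^T *m A *m h c = (a == c)%:R%:M.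
Proof.
elim/index_ind_anti: a c => [a da c|a a' i lt a'E IH c].
  rewrite g_anti //; have [le|lt] := lerP (nrm (wt c)) (nrm (wt a)); last first.
    rewrite (@orth_low (nrm (wt a))) //; last first.
      by move=> l ltl; rewrite mxE; case: (l =P a) => // E; rewrite E ltxx in ltl.
    case: (a =P c) => [E|_]; first by rewrite E ltxx in lt.
    by apply/matrixP => x y; rewrite !mxE mul0rn.
  (* Here |c|^2 <= |a|^2 <= |b|^2 for every b reached by row a of A, so [h_lead] evaluates h_c at
     each such b. A contribution from b = c would force equal norms, hence b = a. *)
  rewrite trmx_delta -rowE; apply/matrixP => x y; rewrite !ord1 !mxE eqxx mulr1n.
  rewrite (bigD1 a) //= mxE A_diag mul1r h_lead // big1 ?addr0 // => b ba.
  rewrite mxE; have [->|/A_upper] := eqVneq (A a b) 0; first by rewrite mul0r.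
  case/(domge_antidominant da) => le' eq'; rewrite h_lead ?(le_trans le le') //.
  case: (b =P c) => [E|_]; last by rewrite mulr0.
  have E' : wt b = wt a by apply: eq'; apply/le_anti; rewrite le' E le.
  by rewrite (wt_inj E') eqxx in ba.
have gE : g a' = p^-1 *: (t' i *m g a) by rewrite (g_swap lt a'E) scalerA mulVf // scale1r.
have a'a : swap i (wt a') = wt a by rewrite a'E swapK.
rewrite gE linearZ /= trmx_mul -!scalemxAl -[_ *m A]mulmxA -A_t -2!mulmxA.
(* T_i now acts on h_c. It gives h_(s_i c) if c_i < c_(i+1), (p - 1) h_c + p h_(s_i c) if c_i >
   c_(i+1), and p h_c in case of equality. Since a_i < a_(i+1), only the middle case can contribute,
   when a = s_i c. *)
have [ltc|gtc|eqc] := ltrgtP (wt c (lo i)) (wt c (hi i)).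
- have /codomP[c' c'E] : swap i (wt c) \in codom wt by exact: wt_wact.
  rewrite (h_swap (j := c')) -?c'E ?swapK ?swap_lo ?swap_hi // mulmxA IH.
  have -> : (a == c') = false.
    by apply/eqP => E; move: lt; rewrite E -c'E swap_lo swap_hi ltNge (ltW ltc).
  have -> : (a' == c) = false.
    by apply/eqP => E; move: ltc; rewrite -E a'E swap_lo swap_hi ltNge (ltW lt).
  by rewrite raddf0 scaler0.
- have /codomP[c' c'E] : swap i (wt c) \in codom wt by exact: wt_wact.
  have hE := h_swap gtc (esym c'E).
  rewrite -{1}hE [t i *m _]mulmxA t_quad mulmxDl -scalemxAl hE mul_scalar_mx mulmxDr mulmxDr.
  rewrite -!scalemxAr !mulmxA !IH.
  have -> : (a == c) = false.
    by apply/eqP => E; move: lt; rewrite E ltNge (ltW gtc).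
  have -> : (a == c') = (a' == c).
    by rewrite -!(inj_eq wt_inj) -c'E -a'a (can_eq (swapK i)).
  by rewrite raddf0 scaler0 add0r scalerA mulVf // scale1r.
rewrite h_eq // -!scalemxAr scalerA mulVf // scale1r mulmxA IH.
have -> : (a == c) = false by apply/eqP => E; move: lt; rewrite E eqc ltxx.
have -> // : (a' == c) = false.
by apply/eqP => E; move: lt eqc; rewrite -E a'E swap_lo swap_hi => lt E'; rewrite E' ltxx in lt.
Qed.

(** Orthogonality reads G A H = 1 for square matrices, so A H G = 1 as well, and multiplying by B =
    A^-1 leaves H G = B. *)
Lemma dual_bases_kernel : \sum_j h j *m (g j)^T = B.
Proof.
pose H : 'M[k]_N := \matrix_(l, j) h j l 0.
pose G : 'M[k]_N := \matrix_(j, l) g j l 0.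
have -> : \sum_j h j *m (g j)^T = H *m G.
  apply/matrixP => a b; rewrite summxE mxE; apply: eq_bigr => j _.
  by rewrite !mxE big_ord1 !mxE.
have GAH : G *m (A *m H) = 1%:M.
  apply/matrixP => a c; have /matrixP/(_ 0 0) := orth a c.
  rewrite -mulmxA [in X in _ = X -> _]mxE eqxx mulr1n => E.
  rewrite [RHS]mxE -[RHS]E !mxE; apply: eq_bigr => l _.
  by rewrite !mxE; congr (_ * _); apply: eq_bigr => b _; rewrite !mxE.
by rewrite -[LHS]mul1mx -{1}BA -mulmxA (mulmxA A) (mulmx1C GAH) mulmx1.
Qed.

End DualBases.

(** * Power series expansions *)

Section Expansion.
Context (L : fieldType).
Implicit Types A C F P Q : {poly L}.

(** Congruence modulo t^(d+1), which lets polynomials stand in for power series. *)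
Definition eqt (d : nat) A C := forall e, (e <= d)%N -> A`_e = C`_e.

Lemma eqtM d A A' C C' : eqt d A A' -> eqt d C C' -> eqt d (A * C) (A' * C').
Proof.
move=> AA CC e le; rewrite !coefM; apply: eq_bigr => j _.
by rewrite AA ?CC // (leq_trans _ le) ?leq_subr // -ltnS.
Qed.

Lemma eqt_prod d (I : Type) (r : seq I) (Q : pred I) (A C : I -> {poly L}) :
  (forall z, Q z -> eqt d (A z) (C z)) ->
  eqt d (\prod_(z <- r | Q z) A z) (\prod_(z <- r | Q z) C z).
Proof. by move=> H; elim/big_ind2: _ => // *; exact: eqtM. Qed.

Lemma expand_unique P Q F d : Q`_0 != 0 -> eqt d (Q * F) P -> expand P Q d = F`_d.
Proof.
move=> nQ; elim/ltn_ind: d => d IH QF.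
have := expand_mul P d nQ; rewrite -(QF d) // coefMr !big_ord_recr /= !subnn.
rewrite (eq_bigr (fun i : 'I_d => Q`_(d - i) * F`_i)).
  by move/addrI/(mulfI nQ).
by move=> i _; rewrite IH // => e le; apply: QF; rewrite (leq_trans le) // ltnW.
Qed.

Definition series P Q (d : nat) : {poly L} := \poly_(i < d.+1) expand P Q i.

Lemma series_mul P Q d : Q`_0 != 0 -> eqt d (Q * series P Q d) P.
Proof.
move=> nQ e le; rewrite coefMr -(expand_mul P e nQ); apply: eq_bigr => i _.
by rewrite coef_poly (leq_trans (ltn_ord i)) // ltnS.
Qed.

Lemma expand_mulr P Q A d : Q`_0 != 0 -> A`_0 != 0 ->
  expand (P * A) (Q * A) d = expand P Q d.
Proof.
move=> nQ nA; rewrite (@expand_unique _ _ (series P Q d)).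
- by rewrite coef_poly ltnSn.
- by rewrite coefM big_ord1 mulf_neq0.
by rewrite mulrAC; apply: eqtM => //; exact: series_mul.
Qed.

(** Division by [Q] becomes multiplication by a polynomial depending on [Q] alone, so that a
    denominator fixed by s_i can be treated as a common factor. *)
Lemma expand_coef P Q d : Q`_0 != 0 -> expand P Q d = (P * series 1 Q d)`_d.
Proof.
move=> nQ; apply: expand_unique => //; rewrite mulrCA -[P in eqt _ _ P]mulr1.
by apply: eqtM => //; exact: series_mul.
Qed.

Lemma expand_map (s : {rmorphism L -> L}) P Q d :
  s (expand P Q d) = expand (map_poly s P) (map_poly s Q) d.
Proof.
have szE A C m : size (expand_seq A C m) = m.
  by elim: m => //= m IH; rewrite size_rcons IH.
suff E m : map s (expand_seq P Q m) = expand_seq (map_poly s P) (map_poly s Q) m.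
  by rewrite /expand -E (nth_map 0) ?szE.
elim: m => //= m IH; rewrite map_rcons IH; congr rcons.
rewrite fmorph_div rmorphB raddf_sum !coef_map /=; congr ((_ - _) / _).
apply: eq_bigr => i _; rewrite rmorphM -IH (nth_map 0) ?szE //= coef_map //.
Qed.

Definition geo (d : nat) (u : L) : {poly L} := \poly_(m < d.+1) u ^+ m.

Lemma geo_mul d u : eqt d ((1 - u *: 'X) * geo d u) 1.
Proof.
move=> e le; rewrite mulrBl mul1r coefB -scalerAl coefZ coefXM coef_poly ltnS le coef1.
case: e le => [|e] le /=; first by rewrite mulr0 subr0.
by rewrite coef_poly ltnS (ltnW le) -exprS subrr.
Qed.

Lemma coef0_prod_sub (I : finType) (Q : pred I) (c : I -> L) :
  (\prod_(z | Q z) (1 - c z *: 'X))`_0 = 1.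
Proof.
elim/big_ind: _ => [|A C A1 C1|z _]; first by rewrite coef1.
  by rewrite coefM big_ord1 A1 C1 mulr1.
by rewrite coefB coef1 coefZ coefX mulr0 subr0.
Qed.

Lemma coef_lin2 (u v : L) m : ((1 - u *: 'X) * (1 - v *: 'X))`_m
  = (m == 0%N)%:R - (m == 1%N)%:R * (u + v) + (m == 2%N)%:R * (u * v).
Proof.
rewrite mulrBl mul1r coefB -scalerAl coefZ coefXM !coefB !coefZ !coefX !coef1.
by case: m => [|[|[|m]]] /=; ring.
Qed.

(* The invariance of the Cauchy kernel comes down to this 2 x 2 block in rows and
   columns i, i + 1, since all the other factors are symmetric. *)
Lemma dl_block (c x x' y y' : L) m :
    c != 0 -> x != 0 -> y' != 0 -> x != x' -> y' != y ->
  dl c^-1 x x'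
    ((1 - (c * x * y') *: 'X) * (1 - (x' * y) *: 'X))`_m
    ((1 - (x * y) *: 'X) * (1 - (c * x' * y') *: 'X))`_m
  = dl c^-1 y' y
    ((1 - (c * x * y') *: 'X) * (1 - (x' * y) *: 'X))`_m
    ((1 - (c * x * y) *: 'X) * (1 - (x' * y') *: 'X))`_m.
Proof.
move=> nc nx ny nxx nyy; rewrite !coef_lin2 /dl.
have inv1B (u v : L) : u != 0 -> 1 / (1 - v / u) = u / (u - v).
  by move=> nu; rewrite -[in 1 - _](divff nu) -mulrBl invf_div mul1r.
by rewrite !inv1B //; field; rewrite nc !subr_eq0 nxx nyy.
Qed.

End Expansion.

(** * Weights of fixed degree *)

Section DegreeWeights.
Context (n d : nat).
Implicit Types (lam mu : weight n.+1) (i : 'I_n).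

Definition homw (e : nat) lam := (forall x, 0 <= lam x) /\ \sum_x lam x = e%:Z.

Definition dmon : {pred 'X_{1..n.+1 < d.+1}} := [pred a : 'X_{1..n.+1 < d.+1} | mdeg a == d].

Definition dwt (j : 'I_#|dmon|) : weight n.+1 := weight_of (enum_val j).

Lemma sum_Posz (F : 'I_n.+1 -> nat) : (\sum_x F x)%N%:Z = \sum_x (F x)%:Z.
Proof. exact: (big_morph Posz PoszD (erefl _)). Qed.

Lemma dwt_homw j : homw d (dwt j).
Proof.
split=> [x|]; first by rewrite ffunE.
have /eqP <- : mdeg (enum_val j) == d := enum_valP j.
by rewrite mdegE sum_Posz; apply: eq_bigr => x _; rewrite ffunE.
Qed.

Lemma dwt_inj : injective dwt.
Proof.
move=> j l E; apply/enum_val_inj/val_inj/mnmP => x.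
by have := congr1 (fun lam : weight n.+1 => lam x) E; rewrite !ffunE => -[].
Qed.

Lemma homw_dwt lam : homw d lam -> lam \in codom dwt.
Proof.
case=> ge0 sum_d; pose a := [multinom absz (lam x) | x < n.+1].
have aE x : (a x)%:Z = lam x by rewrite mnmE gez0_abs.
have deg_a : mdeg a = d.
  apply/eqP; rewrite -eqz_nat -sum_d mdegE sum_Posz.
  by apply/eqP/eq_bigr => x _; rewrite aE.
have lt_a : (mdeg a < d.+1)%N by rewrite deg_a.
have a_in : BMultinom lt_a \in dmon by rewrite inE /= deg_a.
apply/codomP; exists (enum_rank_in a_in (BMultinom lt_a)).
by apply/ffunP => x; rewrite ffunE enum_rankK_in //= aE.
Qed.

Lemma homw_wact e w lam : homw e lam -> homw e (wact w lam).
Proof.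
case=> ge0 sum_e; split=> [x|]; first by rewrite ffunE.
rewrite -sum_e (reindex_inj (@perm_inj _ w)); apply: eq_bigr => x _.
by rewrite ffunE permK.
Qed.

Lemma sum_down i (r : nat) lam : \sum_x down i r lam x = \sum_x lam x.
Proof.
rewrite !(big_lo_hi i) down_lo down_hi.
rewrite [X in _ + (_ + X) = _](eq_bigr lam); first by ring.
by move=> x /andP[l h]; rewrite down_fix // eq_sym.
Qed.

Lemma homw_down i lam (r m : nat) : lam (lo i) = lam (hi i) + m%:Z ->
  (r <= m)%N -> homw d lam -> homw d (down i r lam).
Proof.
move=> E rm [ge0 sum_d]; split=> [x|]; last by rewrite sum_down.
have [<-|l] := eqVneq (lo i) x.
  by rewrite down_lo E -addrA addr_ge0 // subr_ge0 lez_nat.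
have [<-|h] := eqVneq (hi i) x; first by rewrite down_hi addr_ge0.
by rewrite down_fix.
Qed.

Lemma homwN_down i lam (r m : nat) : lam (lo i) = lam (hi i) + m%:Z ->
  (r <= m)%N -> homw d (- lam) -> homw d (- down i r lam).
Proof.
move=> E rm [ge0 sum_d]; have ge0' x : 0 <= - lam x by have := ge0 x; rewrite ffunE.
split=> [x|]; last first.
  rewrite -sum_d (eq_bigr (fun x => - down i r lam x)) => [|x _]; last by rewrite ffunE.
  rewrite [RHS](eq_bigr (fun x => - lam x)) => [|x _]; last by rewrite ffunE.
  by rewrite !sumrN sum_down.
rewrite ffunE; have [<-|l] := eqVneq (lo i) x.
  by rewrite down_lo opprB addr_ge0 // -[r%:Z]opprK.
have [<-|h] := eqVneq (hi i) x; last by rewrite down_fix.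
have := ge0' (lo i); rewrite down_hi E; move: (lam (hi i)) => c; move: rm; lia.
Qed.

Lemma dwt_wact w j : wact w (dwt j) \in codom dwt.
Proof. exact/homw_dwt/homw_wact/dwt_homw. Qed.

Lemma dwt_down i j (r m : nat) : dwt j (lo i) = dwt j (hi i) + m%:Z ->
  (r <= m)%N -> down i r (dwt j) \in codom dwt.
Proof. by move=> E rm; apply/homw_dwt/(homw_down E rm)/dwt_homw. Qed.

Definition dwtN j := - dwt j.

Lemma codom_dwtN lam : (lam \in codom dwtN) = (- lam \in codom dwt).
Proof.
by apply/codomP/codomP => -[j E]; exists j; [rewrite E opprK | rewrite -[lam]opprK E].
Qed.

Lemma dwtN_inj : injective dwtN.
Proof. by move=> j l /oppr_inj/dwt_inj. Qed.

Lemma dwtN_wact w j : wact w (dwtN j) \in codom dwtN.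
Proof. by rewrite codom_dwtN wactN opprK; exact: dwt_wact. Qed.

Lemma dwtN_down i j (r m : nat) : dwtN j (lo i) = dwtN j (hi i) + m%:Z ->
  (r <= m)%N -> down i r (dwtN j) \in codom dwtN.
Proof.
move=> E rm; rewrite codom_dwtN; apply/homw_dwt/(homwN_down E rm).
by rewrite opprK; exact: dwt_homw.
Qed.

(** Multiplying out the diagonal geometric series produces sums over functions with values at most
    d; those of total d are the monomials of degree d. *)
Lemma sum_dmon (V : nmodType) (F : weight n.+1 -> V) :
  \sum_(f : {ffun 'I_n.+1 -> 'I_d.+1} | (\sum_x f x)%N == d) F [ffun x => (f x)%:Z]
  = \sum_j F (dwt j).
Proof.
rewrite -(big_enum_val (A := dmon) (fun a => F (weight_of a))) /=.
pose fm (f : {ffun 'I_n.+1 -> 'I_d.+1}) := [multinom (f x : nat) | x < n.+1].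
have fmE f : mdeg (fm f) = (\sum_x f x)%N.
  by rewrite mdegE; apply: eq_bigr => x _; rewrite mnmE.
pose mf (a : 'X_{1..n.+1 < d.+1}) := [ffun x => inord (a x) : 'I_d.+1].
have mfE a x : (mf a x : nat) = a x.
  rewrite ffunE inordK // (leq_ltn_trans _ (bmdeg a)) // mdegE.
  by rewrite (bigD1 x) //= leq_addr.
have subE (f : {ffun 'I_n.+1 -> 'I_d.+1}) : (\sum_x f x < d.+1)%N -> val (insubd (@bm0 n.+1 d) (fm f)) = fm f.
  by move=> lt; apply: insubdK; rewrite -topredE /= fmE.
rewrite [RHS](reindex_onto (fun f => insubd bm0 (fm f)) mf) => [|a _]; last first.
  apply/val_inj; rewrite subE; first by apply/mnmP => x; rewrite mnmE mfE.
  by rewrite (eq_bigr _ (fun x _ => mfE a x)) -mdegE bmdeg.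
have inE' (f : {ffun 'I_n.+1 -> 'I_d.+1}) : (\sum_x f x)%N == d -> val (insubd (@bm0 n.+1 d) (fm f)) = fm f.
  by move=> /eqP fd; rewrite subE // fd.
apply: eq_big => [f|f /inE' E].
  apply/idP/andP => [fd|[]].
    split; first by rewrite inE /= inE' // fmE.
    by apply/eqP/ffunP => x; apply/val_inj; rewrite /= mfE inE' // mnmE.
  rewrite inE => /eqP dE /eqP fE; rewrite -[X in _ == X]dE mdegE; apply/eqP.
  by apply: eq_bigr => x _; rewrite -{1}fE mfE.
by congr F; apply/ffunP => x; rewrite !ffunE E mnmE.
Qed.

End DegreeWeights.

(** * Triangularity of the Cauchy kernel *)

Section Kernel.
Context (k : fieldType) (n : nat).
Local Notation K2 := (ratfun k (n.+1 + n.+1)).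
Implicit Types (lam mu : weight n.+1) (f g : K2) (i j : 'I_n.+1).

Definition xv i : K2 := rX k (lshift n.+1 i).
Definition yv j : K2 := rX k (rshift n.+1 j).
Definition xm lam : K2 := \prod_i xv i ^ lam i.
Definition ym lam : K2 := \prod_j yv j ^ lam j.

Lemma xv_neq0 i : xv i != 0. Proof. exact: rX_neq0. Qed.
Lemma yv_neq0 i : yv i != 0. Proof. exact: rX_neq0. Qed.

Lemma xmD lam mu : xm (lam + mu) = xm lam * xm mu.
Proof. by rewrite -big_split; apply: eq_bigr => i _; rewrite ffunE expfzDr ?xv_neq0. Qed.

Lemma ymD lam mu : ym (lam + mu) = ym lam * ym mu.
Proof. by rewrite -big_split; apply: eq_bigr => i _; rewrite ffunE expfzDr ?yv_neq0. Qed.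

Definition catw lam mu : weight (n.+1 + n.+1) :=
  [ffun z => match split z with inl i => lam i | inr j => mu j end].

Lemma catw_lmon lam mu : xm lam * ym mu = lmon k (catw lam mu).
Proof.
rewrite /lmon big_split_ord /=; congr (_ * _); apply: eq_bigr => i _; rewrite ffunE.
  by rewrite (unsplitK (inl _ i)).
by rewrite (unsplitK (inr _ i)).
Qed.

Lemma catw_inj lam mu lam' mu' : catw lam mu = catw lam' mu' -> lam = lam' /\ mu = mu'.
Proof.
move/ffunP => E; split; apply/ffunP => i.
  by have := E (lshift _ i); rewrite !ffunE (unsplitK (inl _ i)).
by have := E (rshift _ i); rewrite !ffunE (unsplitK (inr _ i)).
Qed.

Definition kern (N : nat) (W : 'I_N -> weight n.+1) (C : 'M[k]_N) : K2 :=
  \sum_l \sum_j rC _ (C l j) * (xm (W l) * ym (W j)).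

Lemma kern_inj N (W : 'I_N -> weight n.+1) : injective W -> injective (kern W).
Proof.
move=> injW C D E; apply/matrixP => l j; apply/eqP; rewrite -subr_eq0; apply/eqP.
pose V (lj : 'I_N * 'I_N) := catw (W lj.1) (W lj.2).
pose c (lj : 'I_N * 'I_N) := C lj.1 lj.2 - D lj.1 lj.2.
apply: (@lmon_indep k _ _ V c (index_enum _) (index_enum_uniq _) _ _ (l, j)).
- by move=> [a b] [a' b'] _ _ /catw_inj[/injW/= -> /injW/= ->].
- have /eqP := E; rewrite -subr_eq0 /kern !pair_bigA -sumrB => /eqP E'.
  by rewrite -[RHS]E'; apply: eq_bigr => -[a b] _; rewrite -catw_lmon /c /= rmorphB mulrBl.
exact: mem_index_enum.
Qed.

(** Strict decrease is what matters: for a factor x_i y_j with i < j, the pairing of rho with the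
    x-exponent exceeds that with the y-exponent by j - i >= 1. *)
Definition rho : weight n.+1 := [ffun i : 'I_n.+1 => (n - i)%N%:Z].

Lemma rho_dominant : dominant rho.
Proof. by move=> i j ij; rewrite !ffunE lez_nat leq_sub2l. Qed.

Lemma dotwD lam mu nu : dotw (n := n) lam (mu + nu) = dotw lam mu + dotw lam nu.
Proof. by rewrite /dotw -big_split; apply: eq_bigr => i _; rewrite ffunE mulrDr. Qed.

Lemma domgeD lam mu lam' mu' : domge lam mu -> domge lam' mu' ->
  domge (n := n) (lam + lam') (mu + mu').
Proof. by move=> h h' c dc; rewrite !dotwD lerD ?h ?h'. Qed.

Definition unitw i : weight n.+1 := [ffun j => (j == i)%:R].

Lemma dotw_unit lam i : dotw lam (unitw i) = lam i.
Proof.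
rewrite /dotw (bigD1 i) //= ffunE eqxx mulr1 big1 ?addr0 // => j ji.
by rewrite ffunE (negPf ji) mulr0.
Qed.

Lemma domge_unit i j : (i <= j)%N -> domge (unitw i) (unitw j).
Proof. by move=> ij c dc; rewrite !dotw_unit dc. Qed.

Lemma homw_unit i : homw 1 (unitw i).
Proof.
split=> [j|]; first by rewrite ffunE ler0n.
rewrite (bigD1 i) //= ffunE eqxx big1 ?addr0 // => j ji.
by rewrite ffunE (negPf ji).
Qed.

Lemma homwD e e' lam mu : homw e lam -> homw e' mu -> homw (n := n) (e + e') (lam + mu).
Proof.
move=> [l0 le] [m0 me]; split=> [i|]; first by rewrite ffunE addr_ge0.
rewrite PoszD -le -me -big_split; apply: eq_bigr => i _.
by rewrite ffunE.
Qed.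

Lemma xm_unit i : xm (unitw i) = xv i.
Proof.
rewrite /xm (bigD1 i) //= ffunE eqxx big1 ?mulr1 // => j ji.
by rewrite ffunE (negPf ji).
Qed.

Lemma ym_unit i : ym (unitw i) = yv i.
Proof.
rewrite /ym (bigD1 i) //= ffunE eqxx big1 ?mulr1 // => j ji.
by rewrite ffunE (negPf ji).
Qed.

Definition term (z : k * weight n.+1 * weight n.+1) : K2 :=
  rC _ z.1.1 * (xm z.1.2 * ym z.2).

(* The excess e under rho counts off-diagonal factors x_i y_j, so that e > 0 means
   strictly triangular. *)
Definition upper (d e : nat) f := exists2 s : seq (k * weight n.+1 * weight n.+1),
  f = \sum_(z <- s) term z &
  forall z, z \in s -> [/\ homw d z.1.2, homw d z.2, domge z.1.2 z.2
                         & dotw rho z.2 + e%:Z <= dotw rho z.1.2].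

Lemma upper0 d e : upper d e 0.
Proof. by exists [::]; rewrite ?big_nil. Qed.

Lemma upperW d e e' f : (e' <= e)%N -> upper d e f -> upper d e' f.
Proof.
move=> le [s -> sP]; exists s => // z /sP[h1 h2 h3 h4]; split=> //.
by apply: le_trans h4; rewrite lerD2l lez_nat.
Qed.

Lemma upperD d e f g : upper d e f -> upper d e g -> upper d e (f + g).
Proof.
move=> [s -> sP] [r -> rP]; exists (s ++ r); rewrite ?big_cat // => z.
by rewrite mem_cat => /orP[/sP|/rP].
Qed.

Lemma upper_sum d e (I : Type) (r : seq I) (Q : pred I) (F : I -> K2) :
  (forall z, Q z -> upper d e (F z)) -> upper d e (\sum_(z <- r | Q z) F z).
Proof.
by move=> QF; elim/big_ind: _ => // [|f g]; [exact: upper0 | exact: upperD].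
Qed.

Lemma upperM d e d' e' f g : upper d e f -> upper d' e' g ->
  upper (d + d') (e + e') (f * g).
Proof.
move=> [s -> sP] [r -> rP].
exists [seq (z.1.1 * z'.1.1, z.1.2 + z'.1.2, z.2 + z'.2) | z <- s, z' <- r].
  rewrite big_allpairs_dep mulr_suml; apply: eq_bigr => z _; rewrite mulr_sumr.
  apply: eq_bigr => z' _; rewrite /term /= rmorphM xmD ymD.
  have gen (L : comRingType) (a b c a' b' c' : L) :
      a * (b * c) * (a' * (b' * c')) = a * a' * (b * b' * (c * c')) by ring.
  exact: gen.
move=> _ /allpairsP[[z z'] /= [/sP[h1 h2 h3 h4] /rP[h1' h2' h3' h4'] ->]] /=.
split; [exact: homwD | exact: homwD | exact: domgeD |].
by rewrite !dotwD PoszD addrACA lerD.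
Qed.

Lemma xm0 : xm 0 = 1.
Proof. by rewrite /xm big1 // => i _; rewrite ffunE. Qed.

Lemma ym0 : ym 0 = 1.
Proof. by rewrite /ym big1 // => i _; rewrite ffunE. Qed.

Lemma upperC c : upper 0 0 (rC _ c).
Proof.
exists [:: (c, 0, 0)]; first by rewrite big_seq1 /term /= xm0 ym0 !mulr1.
move=> z; rewrite inE => /eqP-> /=; rewrite addr0; split=> //; try exact: domge_refl.
all: by split=> [i|]; [rewrite ffunE | rewrite big1 // => i _; rewrite ffunE].
Qed.

Lemma upper1 : upper 0 0 1.
Proof. by have := upperC 1; rewrite rmorph1. Qed.

Lemma upper_xy i j : (i < j)%N -> upper 1 1 (xv i * yv j).
Proof.
move=> ij; exists [:: (1, unitw i, unitw j)].
  by rewrite big_seq1 /term /= xm_unit ym_unit rmorph1 mul1r.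
move=> z; rewrite inE => /eqP-> /=; split; try exact: homw_unit.
  exact/domge_unit/ltnW.
by rewrite !dotw_unit !ffunE -PoszD lez_nat; have := ltn_ord j; lia.
Qed.

Lemma upper_exp e f m : upper 1 e f -> upper m (m * e) (f ^+ m).
Proof.
move=> uf; elim: m => [|m IH]; first exact: upper1.
by rewrite exprS mulSn; exact: (upperM uf IH).
Qed.

Definition upperp (A : {poly K2}) := forall m, upper m m A`_m.

Lemma upperpM A C : upperp A -> upperp C -> upperp (A * C).
Proof.
move=> uA uC m; rewrite coefM; apply: upper_sum => i _.
by have := upperM (uA i) (uC (m - i)%N); rewrite subnKC // -ltnS.
Qed.

Lemma upperp1 : upperp 1.
Proof.
move=> [|m]; rewrite coef1; last exact: upper0.
exact: upper1.
Qed.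

Lemma upperp_prod (I : Type) (r : seq I) (Q : pred I) (F : I -> {poly K2}) :
  (forall z, Q z -> upperp (F z)) -> upperp (\prod_(z <- r | Q z) F z).
Proof.
by move=> QF; elim/big_ind: _ => // [|A C]; [exact: upperp1 | exact: upperpM].
Qed.

Lemma upperp_sub c f : upper 1 1 f -> upperp (1 - (rC _ c * f) *: 'X).
Proof.
move=> uf m; rewrite coefB coefZ coefX.
case: m => [|[|m]]; rewrite coef1 /= ?mulr0 ?subr0 ?mulr1 ?sub0r.
- exact: upper1.
- by rewrite -mulNr -rmorphN; exact: (upperM (upperC _) uf).
exact: upper0.
Qed.

Lemma upperp_geo d f : upper 1 1 f -> upperp (geo d f).
Proof.
move=> uf m; rewrite coef_poly; case: ifP => _; last exact: upper0.
by have := upper_exp m uf; rewrite muln1.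
Qed.

Context (q : k) (d : nat).

Definition Znum : {poly K2} := \prod_(i < n.+1) \prod_(j < n.+1 | (i < j)%N)
  (1 - (rC _ q * xv i * yv j) *: 'X).
Definition Zden : {poly K2} := \prod_(i < n.+1) \prod_(j < n.+1 | (i <= j)%N)
  (1 - (xv i * yv j) *: 'X).

(** Factors with i < j are kept apart from the diagonal ones, since only they move a monomial off
    the diagonal of the coefficient matrix. *)
Definition Zoff : {poly K2} := \prod_(i < n.+1) \prod_(j < n.+1 | (i < j)%N)
  ((1 - (rC _ q * xv i * yv j) *: 'X) * geo d (xv i * yv j)).
Definition Zdiag : {poly K2} := \prod_(i < n.+1) geo d (xv i * yv i).

Lemma Zden0 : Zden`_0 = 1.
Proof.
rewrite /Zden; elim/big_ind: _ => [|A C A1 C1|i _]; first by rewrite coef1.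
  by rewrite coefM big_ord1 A1 C1 mulr1.
exact: coef0_prod_sub.
Qed.

Lemma expand_Z : expand Znum Zden d = (Zdiag * Zoff)`_d.
Proof.
apply: expand_unique; first by rewrite Zden0 oner_neq0.
rewrite /Zden /Zdiag /Zoff /Znum -!big_split /=; apply: eqt_prod => i _.
rewrite (bigD1 i) //= (eq_bigl (fun j : 'I_n.+1 => (i < j)%N)); last first.
  by move=> j; rewrite ltn_neqAle andbC eq_sym.
rewrite mulrACA -big_split /= -[X in eqt d _ X]mul1r; apply: eqtM; first exact: geo_mul.
apply: eqt_prod => j _; rewrite mulrCA -[X in eqt d _ X]mulr1; apply: eqtM => //.
exact: geo_mul.
Qed.

Lemma Zoff_upper : upperp Zoff.
Proof.
apply: upperp_prod => i _; apply: upperp_prod => j ij; apply: upperpM.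
  by rewrite -mulrA; apply/upperp_sub/upper_xy.
exact/upperp_geo/upper_xy.
Qed.

Lemma Zoff0 : Zoff`_0 = 1.
Proof.
rewrite /Zoff; elim/big_ind: _ => [|A C A1 C1|i _]; first by rewrite coef1.
  by rewrite coefM big_ord1 A1 C1 mulr1.
elim/big_ind: _ => [|A C A1 C1|j _]; first by rewrite coef1.
  by rewrite coefM big_ord1 A1 C1 mulr1.
by rewrite coefM big_ord1 coefB coef1 coefZ coefX mulr0 subr0 coef_poly /= mulr1.
Qed.

Lemma Z_split : exists2 f, upper d 1 f
  & expand Znum Zden d = \sum_j xm (dwt (d := d) j) * ym (dwt j) + f.
Proof.
(* [f i] is the exponent taken from the i-th diagonal series. Choices of total d meet the constant
   term of [Zoff] and give the identity matrix; a smaller total leaves a positive degree to [Zoff],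
   hence at least one off-diagonal factor. *)
pose c (f : {ffun 'I_n.+1 -> 'I_d.+1}) : K2 :=
  xm [ffun i => (f i)%:Z] * ym [ffun i => (f i)%:Z].
have ZdiagE : Zdiag = \sum_f c f *: 'X^(\sum_i f i).
  rewrite /Zdiag; under eq_bigr do rewrite /geo poly_def.
  rewrite bigA_distr_bigA /=; apply: eq_bigr => f _.
  rewrite scaler_prod prodrXr; congr (_ *: _).
  by rewrite /c -big_split; apply: eq_bigr => i _; rewrite !ffunE exprMn.
have E : expand Znum Zden d = \sum_f c f * (if (d < \sum_i f i)%N then 0 else Zoff`_(d - \sum_i f i)).
  rewrite expand_Z ZdiagE mulr_suml coef_sum; apply: eq_bigr => f _.
  by rewrite -scalerAl coefZ coefXnM.
rewrite (bigID (fun f : {ffun 'I_n.+1 -> 'I_d.+1} => (\sum_i f i)%N == d)) /= in E.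
eexists; last first.
  rewrite E; congr (_ + _); rewrite -(@sum_dmon n d _ (fun lam => xm lam * ym lam)).
  by apply: eq_bigr => f /eqP fd; rewrite fd ltnn subnn Zoff0 mulr1.
apply: upper_sum => f ne; case: ltnP => [_|le]; first by rewrite mulr0; exact: upper0.
have cU : upper (\sum_i f i)%N 0 (c f).
  have hf : homw (\sum_i f i)%N [ffun i => (f i)%:Z].
    split=> [i|]; first by rewrite ffunE.
    by rewrite sum_Posz; apply: eq_bigr => i _; rewrite ffunE.
  exists [:: (1, [ffun i => (f i)%:Z], [ffun i => (f i)%:Z])].
    by rewrite big_seq1 /term /= rmorph1 mul1r.
  move=> z; rewrite inE => /eqP-> /=; rewrite addr0; split=> //; exact: domge_refl.
apply: (@upperW _ (d - \sum_i f i)); first by rewrite subn_gt0 ltn_neqAle ne.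
have := upperM cU (Zoff_upper (d - \sum_i f i)%N); rewrite add0n. by rewrite subnKC.
Qed.

Local Notation wt := (@dwt n d).

Lemma Z_kern : exists2 M : 'M[k]_#|@dmon n d|,
  (forall l j : 'I_#|@dmon n d|, M l j != 0 -> domge (wt l) (wt j) /\ dotw rho (wt j) < dotw rho (wt l))
  & expand Znum Zden d = kern wt (1%:M - M).
Proof.
have [f [s fE sP] ->] := Z_split.
(* Several terms of the list may share a pair of weights, so their coefficients are added; the sign
   is the one for which the kernel matrix is 1 - M. *)
pose M : 'M[k]_#|@dmon n d| :=
  \matrix_(l, j) - \sum_(z <- s | (z.1.2 == wt l) && (z.2 == wt j)) z.1.1.
exists M.
  move=> l j; rewrite mxE oppr_eq0 => nz.
  have [|/hasPn none] := boolP (has (fun z => (z.1.2 == wt l) && (z.2 == wt j)) s).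
    case/hasP => z /sP[_ _ h1 h2] /andP[/eqP<- /eqP<-]; split=> //.
    by rewrite -lezD1.
  by move: nz; rewrite big_seq_cond big1 ?eqxx // => z /andP[/none/negPf->].
pose D (l j : 'I_#|@dmon n d|) : K2 := xm (wt l) * ym (wt j).
have -> : kern wt (1%:M - M) = \sum_l \sum_j rC _ (l == j)%:R * D l j
  + \sum_l \sum_j \sum_(z <- s)
      (if (z.1.2 == wt l) && (z.2 == wt j) then rC _ z.1.1 * D l j else 0).
  rewrite -big_split; apply: eq_bigr => l _; rewrite -big_split; apply: eq_bigr => j _.
  by rewrite !mxE opprK rmorphD mulrDl raddf_sum mulr_suml /= [in LHS]big_mkcond.
congr (_ + _).
  apply: eq_bigr => l _; rewrite (bigD1 l) //= eqxx rmorph1 mul1r big1 ?addr0 // => j jl.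
  by rewrite eq_sym (negPf jl) rmorph0 mul0r.
under [RHS]eq_bigr => l _ do rewrite exchange_big /=.
rewrite exchange_big fE /=; apply: eq_big_seq => z /sP[h1 h2 _ _].
have [l lE] := codomP (homw_dwt h1); have [j jE] := codomP (homw_dwt h2).
rewrite (bigD1 l) //= (bigD1 j) //= lE jE !eqxx /= /term lE jE.
rewrite big1 => [|j' jj]; last by rewrite (inj_eq (@dwt_inj _ _)) eq_sym (negPf jj).
rewrite addr0 big1 ?addr0 // => l' ll; apply: big1 => j' _.
by rewrite (inj_eq (@dwt_inj _ _)) eq_sym (negPf ll).
Qed.

End Kernel.

(** * Invariance of the Cauchy kernel *)

Section KernelInvariance.
Context (k : fieldType) (n : nat) (q : k).
Hypothesis q_neq0 : q != 0.
Local Notation p := (q^-1).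
Local Notation K2 := (ratfun k (n.+1 + n.+1)).
Local Notation pair := ('I_n.+1 * 'I_n.+1)%type.
Local Notation PP := (rC (n.+1 + n.+1) p).
Local Notation QQ := (rC (n.+1 + n.+1) q).
Local Notation X := (@xv k n).
Local Notation Y := (@yv k n).
Implicit Types (a b : 'I_n.+1) (f g : K2).

(** Over the common denominator prod_(a,b) (1 - t x_a y_b), symmetric in x and in y separately, the
    numerator has the factor 1 - q t x_a y_b for a < b, 1 - t x_a y_b for a > b, and 1 on the
    diagonal. *)
Definition cc a b : K2 := if (a < b)%N then QQ else if (b < a)%N then 1 else 0.

Definition Zfac (c : 'I_n.+1 -> 'I_n.+1 -> K2) (ab : pair) : {poly K2} :=
  1 - (c ab.1 ab.2 * X ab.1 * Y ab.2) *: 'X.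

Definition Zall : {poly K2} := \prod_ab Zfac (fun _ _ => 1) ab.

Lemma Zall0 : Zall`_0 != 0.
Proof. by rewrite coef0_prod_sub oner_neq0. Qed.

Lemma expand_Zall d : expand (Znum n q) (Zden k n) d = expand (\prod_ab Zfac cc ab) Zall d.
Proof.
pose Mid : {poly K2} := \prod_(ab : pair) if (ab.2 < ab.1)%N then Zfac (fun _ _ => 1) ab else 1.
have Mid0 : Mid`_0 != 0.
  by rewrite /Mid -big_mkcond coef0_prod_sub oner_neq0.
have -> : \prod_ab Zfac cc ab = Znum n q * Mid.
  rewrite /Znum pair_big_dep [X in _ = X * _]big_mkcond /Mid -big_split; apply: eq_bigr => -[a b] _ /=.
  rewrite /Zfac /cc /=; case: ltngtP => _; rewrite ?mul1r ?mulr1 //.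
  by rewrite !mul0r scale0r subr0.
have -> : Zall = Zden k n * Mid.
  rewrite /Zden pair_big_dep [X in _ = X * _]big_mkcond /Mid -big_split; apply: eq_bigr => -[a b] _ /=.
  by rewrite /Zfac /=; case: ltngtP => _; rewrite ?mul1r ?mulr1.
apply/esym; apply: expand_mulr; last exact: Mid0.
by rewrite Zden0; exact: oner_neq0.
Qed.

Definition Xperm_indep (i : 'I_n) :=
  @alg_indep_rX k _ _ _ (@perm_inj _ (tperm (lshift n.+1 (lo i)) (lshift n.+1 (hi i)))).
Definition Yperm_indep (i : 'I_n) :=
  @alg_indep_rX k _ _ _ (@perm_inj _ (tperm (rshift n.+1 (lo i)) (rshift n.+1 (hi i)))).

Definition sX i : {rmorphism K2 -> K2} := subst_of (@Xperm_indep i).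
Definition sY i : {rmorphism K2 -> K2} := subst_of (@Yperm_indep i).

Lemma sX_rC i c : sX i (rC _ c) = rC _ c. Proof. exact: subst_of_rC. Qed.
Lemma sY_rC i c : sY i (rC _ c) = rC _ c. Proof. exact: subst_of_rC. Qed.

Lemma sX_X i a : sX i (X a) = X (sref i a).
Proof.
rewrite [LHS](subst_of_rX (@Xperm_indep i) (lshift n.+1 a)) /xv srefE; congr rX; case: (tpermP (lo i)) => [->|->|na nb].
- by rewrite tpermL.
- by rewrite tpermR.
by rewrite tpermD // (inj_eq (@lshift_inj _ _)) eq_sym; apply/eqP.
Qed.

Lemma sX_Y i a : sX i (Y a) = Y a.
Proof. by rewrite [LHS](subst_of_rX (@Xperm_indep i) (rshift n.+1 a)) /yv tpermD // eq_lrshift. Qed.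

Lemma sY_X i a : sY i (X a) = X a.
Proof. by rewrite [LHS](subst_of_rX (@Yperm_indep i) (lshift n.+1 a)) /xv tpermD // eq_rlshift. Qed.

Lemma sY_Y i a : sY i (Y a) = Y (sref i a).
Proof.
rewrite [LHS](subst_of_rX (@Yperm_indep i) (rshift n.+1 a)) /yv srefE; congr rX; case: (tpermP (lo i)) => [->|->|na nb].
- by rewrite tpermL.
- by rewrite tpermR.
by rewrite tpermD // (inj_eq (@rshift_inj _ _)) eq_sym; apply/eqP.
Qed.

Lemma map_Zfac (s : {rmorphism K2 -> K2}) c (u v : 'S_n.+1) :
    (forall a, s (X a) = X (u a)) -> (forall a, s (Y a) = Y (v a)) ->
    (forall a b, s (c a b) = c a b) ->
  map_poly s (\prod_ab Zfac c ab)
  = \prod_ab Zfac (fun a b => c ((u^-1)%g a) ((v^-1)%g b)) ab.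
Proof.
move=> sx sy sc; rewrite rmorph_prod.
have inj : injective (fun ab : pair => (u ab.1, v ab.2)).
  by move=> [a b] [a' b'] [/perm_inj-> /perm_inj->].
rewrite [RHS](reindex_inj inj); apply: eq_bigr => -[a b] _.
by rewrite /Zfac rmorphB rmorph1 /= map_polyZ map_polyX !rmorphM /= sx sy sc !permK.
Qed.

Definition inv_at i f f1 f2 :=
  dl PP (X (lo i)) (X (hi i)) f f1 = dl PP (Y (hi i)) (Y (lo i)) f f2.

Lemma inv_at_coefM i (A A1 A2 C : {poly K2}) :
  (forall m, inv_at i A`_m A1`_m A2`_m) ->
  forall m, inv_at i (A * C)`_m (A1 * C)`_m (A2 * C)`_m.
Proof.
move=> H m.
have dl_sum (x y : K2) (B B1 : {poly K2}) :
    dl PP x y (B * C)`_m (B1 * C)`_m = \sum_(e < m.+1) dl PP x y B`_e B1`_e * C`_(m - e).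
  rewrite !coefM /dl -sumrB !mulr_sumr -big_split; apply: eq_bigr => e _ /=.
  have gen (S : comRingType) (u v b b1 c : S) :
      u * (b1 * c) + v * (b1 * c - b * c) = (u * b1 + v * (b1 - b)) * c by ring.
  exact: gen.
by rewrite /inv_at !dl_sum; apply: eq_bigr => e _; rewrite H.
Qed.

Lemma inv_block i m : inv_at i
  ((1 - (QQ * X (lo i) * Y (hi i)) *: 'X) * (1 - (X (hi i) * Y (lo i)) *: 'X))`_m
  ((1 - (X (lo i) * Y (lo i)) *: 'X) * (1 - (QQ * X (hi i) * Y (hi i)) *: 'X))`_m
  ((1 - (QQ * X (lo i) * Y (lo i)) *: 'X) * (1 - (X (hi i) * Y (hi i)) *: 'X))`_m.
Proof.
rewrite /inv_at fmorphV; apply: dl_block.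
- by rewrite fmorph_eq0.
- exact: xv_neq0.
- exact: yv_neq0.
- by rewrite (inj_eq (@rX_inj k _)) (inj_eq (@lshift_inj _ _)) lo_neq_hi.
by rewrite (inj_eq (@rX_inj k _)) (inj_eq (@rshift_inj _ _)) eq_sym lo_neq_hi.
Qed.

Definition blk (i : 'I_n) (ab : pair) : bool :=
  ((ab.1 == lo i) || (ab.1 == hi i)) && ((ab.2 == lo i) || (ab.2 == hi i)).

Lemma prod_blk i (F : pair -> {poly K2}) : \prod_(ab | blk i ab) F ab =
  F (lo i, lo i) * F (lo i, hi i) * (F (hi i, lo i) * F (hi i, hi i)).
Proof.
have two (G : 'I_n.+1 -> {poly K2}) :
    \prod_(a | (a == lo i) || (a == hi i)) G a = G (lo i) * G (hi i).
  rewrite (bigD1 (lo i)) ?eqxx //= (big_pred1 (hi i)) // => a /=.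
  by have [->|] := eqVneq a (lo i); rewrite ?andbT //= (negPf (lo_neq_hi i)).
have -> : \prod_(ab | blk i ab) F ab
   = \prod_(a | (a == lo i) || (a == hi i)) \prod_(b | (b == lo i) || (b == hi i)) F (a, b).
  by rewrite pair_big; apply: eq_big => -[a b].
by rewrite two !two.
Qed.

(** [cc] depends only on the relative order of a and b, which s_i applied to one of them can alter
    only when both lie in {i, i + 1}. *)
Lemma cc_swapl i a b : ~~ blk i (a, b) -> cc (sref i a) b = cc a b.
Proof.
rewrite negb_and /= => nb.
have [na|/negPn ina] := boolP (~~ ((a == lo i) || (a == hi i))).
  by case/norP: na => la ha; rewrite sref_fix // eq_sym.
have {}nb : ~~ ((b == lo i) || (b == hi i)) by move: nb; rewrite ina.
have fb : sref i b = b by case/norP: nb => lb hb; rewrite sref_fix // eq_sym.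
have lt_iff (x y : 'I_n.+1) : (x, y) != (lo i, hi i) ->
    (sref i x, sref i y) != (lo i, hi i) -> (sref i x < sref i y)%N = (x < y)%N.
  move=> h1 h2; apply/idP/idP => lt; last exact: sref_lt.
  by have := sref_lt lt h2; rewrite -!permM srefK !perm1.
case/norP: nb => lb hb.
have := lt_iff a b; have := lt_iff b a; rewrite fb !xpair_eqE.
by rewrite (negPf lb) (negPf hb) !andbF /= /cc => -> // ->.
Qed.

Lemma cc_swapr i a b : ~~ blk i (a, b) -> cc a (sref i b) = cc a b.
Proof.
rewrite negb_and /= => nb.
have [na|/negPn ina] := boolP (~~ ((b == lo i) || (b == hi i))).
  by case/norP: na => la ha; rewrite sref_fix // eq_sym.
have {}nb : ~~ ((a == lo i) || (a == hi i)) by move: nb; rewrite ina orbF.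
have fb : sref i a = a by case/norP: nb => lb hb; rewrite sref_fix // eq_sym.
have lt_iff (x y : 'I_n.+1) : (x, y) != (lo i, hi i) ->
    (sref i x, sref i y) != (lo i, hi i) -> (sref i x < sref i y)%N = (x < y)%N.
  move=> h1 h2; apply/idP/idP => lt; last exact: sref_lt.
  by have := sref_lt lt h2; rewrite -!permM srefK !perm1.
case/norP: nb => lb hb.
have := lt_iff a b; have := lt_iff b a; rewrite fb !xpair_eqE.
by rewrite (negPf lb) (negPf hb) !andbF /= /cc => -> // ->.
Qed.

Lemma inv_num i m : inv_at i (\prod_ab Zfac cc ab)`_m
  (\prod_ab Zfac (fun a b => cc (sref i a) b) ab)`_m
  (\prod_ab Zfac (fun a b => cc a (sref i b)) ab)`_m.
Proof.
have ltlh : (lo i < hi i)%N = true by rewrite ltnSn.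
have lthl : (hi i < lo i)%N = false by rewrite ltnNge leqnSn.
have split c : (forall a b, ~~ blk i (a, b) -> c a b = cc a b) ->
    \prod_ab Zfac c ab = \prod_(ab | blk i ab) Zfac c ab * \prod_(ab | ~~ blk i ab) Zfac cc ab.
  move=> cE; rewrite (bigID (blk i)) /=; congr (_ * _); apply: eq_bigr => -[a b] nb.
  by rewrite /Zfac /= cE.
rewrite (split cc) // (split _ (@cc_swapl i)) (split _ (@cc_swapr i)).
(* In each of the three products two of the four block factors are trivial, because [cc] vanishes on
   the diagonal; the other two are those of [inv_block]. *)
apply: inv_at_coefM => {}m; rewrite !prod_blk /Zfac /= !sref_lo !sref_hi /cc !ltnn ltlh lthl.
rewrite !mul0r !scale0r !subr0 !mul1r !mulr1; exact: inv_block.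
Qed.

Lemma Z_invariant i d : inv_at i (expand (Znum n q) (Zden k n) d)
  (sX i (expand (Znum n q) (Zden k n) d)) (sY i (expand (Znum n q) (Zden k n) d)).
Proof.
have sXcc a b : sX i (cc a b) = cc a b.
  by rewrite /cc; case: ifP => _; last case: ifP => _; rewrite ?sX_rC ?rmorph1 ?rmorph0.
have sYcc a b : sY i (cc a b) = cc a b.
  by rewrite /cc; case: ifP => _; last case: ifP => _; rewrite ?sY_rC ?rmorph1 ?rmorph0.
have XW : map_poly (sX i) Zall = Zall.
  rewrite /Zall (map_Zfac (u := sref i) (v := 1%g)) // => [a|a|a b].
  - exact: sX_X. - by rewrite sX_Y perm1. - exact: rmorph1.
have YW : map_poly (sY i) Zall = Zall.
  rewrite /Zall (map_Zfac (u := 1%g) (v := sref i)) // => [a|a|a b].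
  - by rewrite sY_X perm1. - exact: sY_Y. - exact: rmorph1.
have XN : map_poly (sX i) (\prod_ab Zfac cc ab) = \prod_ab Zfac (fun a b => cc (sref i a) b) ab.
  rewrite (map_Zfac (u := sref i) (v := 1%g) (sX_X i) _ sXcc).
    by apply: eq_bigr => -[a b] _; rewrite /Zfac srefV invg1 perm1.
  by move=> a; rewrite sX_Y perm1.
have YN : map_poly (sY i) (\prod_ab Zfac cc ab) = \prod_ab Zfac (fun a b => cc a (sref i b)) ab.
  rewrite (map_Zfac (u := 1%g) (v := sref i) _ (sY_Y i) sYcc).
    by apply: eq_bigr => -[a b] _; rewrite /Zfac srefV invg1 perm1.
  by move=> a; rewrite sY_X perm1.
(* Both reflections fix the denominator, so its inverse series is the same factor in all three
   coefficients and only the numerators matter. *)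
rewrite expand_Zall !expand_map XW YW XN YN !(expand_coef _ _ Zall0).
by apply: inv_at_coefM => m; exact: inv_num.
Qed.

End KernelInvariance.

(** * The Cauchy identity *)

Lemma fmorph_dl (L L' : fieldType) (s : {rmorphism L -> L'}) (c x y f g : L) :
  s (dl c x y f g) = dl (s c) (s x) (s y) (s f) (s g).
Proof. by rewrite /dl rmorphD !(rmorphM, rmorphB, fmorphV, rmorph1). Qed.

Section Cauchy.
Context (k : fieldType) (n : nat) (q : k).
Hypothesis q_neq0 : q != 0.
Local Notation p := (q^-1).
Local Notation K2 := (ratfun k (n.+1 + n.+1)).
Local Notation K := (ratfun k n.+1).
Local Notation PP := (rC (n.+1 + n.+1) p).
Local Notation X := (@xv k n).
Local Notation Y := (@yv k n).
Local Notation T := (@DLop k n p).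
Local Notation E := (@nsE k n p).
Implicit Types (i : 'I_n) (lam : weight n.+1) (f : K).

Let p_neq0 : p != 0. Proof. by rewrite invr_eq0. Qed.

Definition xv_indep : alg_indep X := @alg_indep_rX k _ _ _ (@lshift_inj n.+1 n.+1).
Definition yv_indep : alg_indep Y := @alg_indep_rX k _ _ _ (@rshift_inj n.+1 n.+1).

Lemma yvV_indep : alg_indep (fun a => (Y a)^-1).
Proof.
apply: (@lmon_alg_indep _ _ _ _ (fun a => catw 0 (- weight_of a))).
  move=> a b /catw_inj[_ /oppr_inj/ffunP ab]; apply/mnmP => i.
  by have := ab i; rewrite !ffunE => -[].
move=> a; rewrite -catw_lmon xm0 mul1r; apply: eq_bigr => i _.
by rewrite !ffunE exprVn -invr_expz.
Qed.

Definition phiX : {rmorphism K -> K2} := subst_of xv_indep.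
Definition psiY : {rmorphism K -> K2} := subst_of yvV_indep.

Lemma phiX_rX a : phiX (rX k a) = X a. Proof. exact: subst_of_rX. Qed.
Lemma psiY_rX a : psiY (rX k a) = (Y a)^-1. Proof. exact: subst_of_rX. Qed.
Lemma phiX_rC c : phiX (rC _ c) = rC _ c. Proof. exact: subst_of_rC. Qed.
Lemma psiY_rC c : psiY (rC _ c) = rC _ c. Proof. exact: subst_of_rC. Qed.

Lemma phiX_xmon lam : phiX (xmon k lam) = xm k lam.
Proof. by rewrite rmorph_prod; apply: eq_bigr => a _; rewrite fmorphXz phiX_rX. Qed.

Lemma psiY_xmon lam : psiY (xmon k lam) = ym k (- lam).
Proof.
rewrite rmorph_prod; apply: eq_bigr => a _.
by rewrite fmorphXz psiY_rX ffunE exprz_inv.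
Qed.

Lemma phiX_sref i f : phiX (ract (sref i) f) = sX k i (phiX f).
Proof.
apply: (@ratfun_morph_eq _ _ _ (phiX \o ract (sref i)) (sX k i \o phiX)) => [c|a] /=.
  by rewrite ract_rC phiX_rC sX_rC.
by rewrite ract_rX !phiX_rX sX_X.
Qed.

Lemma psiY_sref i f : psiY (ract (sref i) f) = sY k i (psiY f).
Proof.
apply: (@ratfun_morph_eq _ _ _ (psiY \o ract (sref i)) (sY k i \o psiY)) => [c|a] /=.
  by rewrite ract_rC psiY_rC sY_rC.
by rewrite ract_rX !psiY_rX fmorphV sY_Y.
Qed.

Lemma phiX_DLop i f :
  phiX (T i f) = dl PP (X (lo i)) (X (hi i)) (phiX f) (sX k i (phiX f)).
Proof.
by rewrite DLopE fmorph_dl phiX_rC !phiX_rX phiX_sref.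
Qed.

Lemma psiY_DLop i f :
  psiY (T i f) = dl PP (Y (hi i)) (Y (lo i)) (psiY f) (sY k i (psiY f)).
Proof.
rewrite DLopE fmorph_dl psiY_rC !psiY_rX psiY_sref /dl invrK.
by rewrite [_^-1 * Y _]mulrC.
Qed.

Context (d : nat).
Local Notation N := #|@dmon n d|.
Local Notation wt := (@dwt n d).
Local Notation wtN := (@dwtN n d).
Local Notation t := (tmx p wt).
Local Notation t' := (tmx p wtN).
Implicit Types (j l : 'I_N) (C : 'M[k]_N).

Let t_emb := emb_tmx (k := k) p (@dwt_inj n d) (@dwt_wact n d) (@dwt_down n d).
Let t'_emb := emb_tmx (k := k) p (@dwtN_inj n d) (@dwtN_wact n d) (@dwtN_down n d).

Lemma phiX_emb (v : 'cV[k]_N) : phiX (emb wt v) = \sum_l rC _ (v l 0) * xm k (wt l).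
Proof.
by rewrite rmorph_sum; apply: eq_bigr => l _; rewrite rmorphM phiX_rC phiX_xmon.
Qed.

Lemma psiY_emb (v : 'cV[k]_N) : psiY (emb wtN v) = \sum_l rC _ (v l 0) * ym k (wt l).
Proof.
by rewrite rmorph_sum; apply: eq_bigr => l _; rewrite rmorphM psiY_rC psiY_xmon opprK.
Qed.

Lemma kern_mul (u v : 'cV[k]_N) :
  phiX (emb wt u) * psiY (emb wtN v) = kern wt (u *m v^T).
Proof.
rewrite phiX_emb psiY_emb mulr_suml; apply: eq_bigr => l _; rewrite mulr_sumr.
apply: eq_bigr => j _; rewrite mxE big_ord1 mxE rmorphM.
by rewrite mulrACA.
Qed.

Lemma kern_sum (I : Type) (r : seq I) (F : I -> 'M[k]_N) :
  kern wt (\sum_(z <- r) F z) = \sum_(z <- r) kern wt (F z).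
Proof.
rewrite /kern [RHS]exchange_big; apply: eq_bigr => l _ /=; rewrite [RHS]exchange_big.
by apply: eq_bigr => j _ /=; rewrite summxE raddf_sum mulr_suml.
Qed.

Lemma kern_cols C : kern wt C = \sum_j phiX (emb wt (col j C)) * ym k (wt j).
Proof.
rewrite /kern exchange_big; apply: eq_bigr => j _; rewrite phiX_emb mulr_suml.
by apply: eq_bigr => l _; rewrite mxE mulrA.
Qed.

Lemma kern_rows C : kern wt C = \sum_l psiY (emb wtN (row l C)^T) * xm k (wt l).
Proof.
apply: eq_bigr => l _; rewrite psiY_emb mulr_suml.
by apply: eq_bigr => j _; rewrite !mxE mulrA mulrAC.
Qed.

Lemma dl_scale_sum (s : {rmorphism K2 -> K2}) (x y : K2) (F G : 'I_N -> K2) :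
  (forall j, s (G j) = G j) ->
  dl PP x y (\sum_j F j * G j) (s (\sum_j F j * G j)) = \sum_j dl PP x y (F j) (s (F j)) * G j.
Proof.
move=> sG; rewrite rmorph_sum /dl -sumrB !mulr_sumr -big_split; apply: eq_bigr => j _ /=.
rewrite rmorphM /= sG.
have gen (S : comRingType) (u v b b1 c : S) :
  u * (b1 * c) + v * (b1 * c - b * c) = (u * b1 + v * (b1 - b)) * c by ring.
exact: gen.
Qed.

(** With [kern_tY] and [kern_inj], this turns the invariance of the kernel into the matrix identity
    t B = B t'^T. *)
Lemma kern_tX i C :
  dl PP (X (lo i)) (X (hi i)) (kern wt C) (sX k i (kern wt C)) = kern wt (t i *m C).
Proof.
rewrite !kern_cols dl_scale_sum => [|j].
  by apply: eq_bigr => j _; rewrite -phiX_DLop -t_emb !colE mulmxA.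
by rewrite rmorph_prod; apply: eq_bigr => a _; rewrite fmorphXz sX_Y.
Qed.

Lemma kern_tY i C :
  dl PP (Y (hi i)) (Y (lo i)) (kern wt C) (sY k i (kern wt C)) = kern wt (C *m (t' i)^T).
Proof.
rewrite !kern_rows dl_scale_sum => [|j].
  apply: eq_bigr => j _; rewrite -psiY_DLop -t'_emb; congr (psiY (emb _ _) * _).
  by rewrite row_mul trmx_mul trmxK.
by rewrite rmorph_prod; apply: eq_bigr => a _; rewrite fmorphXz sY_X.
Qed.

Lemma nsH_emb : exists h : 'I_N -> 'cV[k]_N, forall j, nsH p (wt j) = emb wt (h j).
Proof.
apply: (@fin_all_exists _ (fun=> 'cV[k]_N) (fun j v => nsH p (wt j) = emb wt v)) => j.
have [v vE] := nsE_emb p_neq0 (@dwt_inj n d) (@dwt_wact n d) (@dwt_down n d) (dwt_wact (w0 n.+1) j).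
exists (p ^+ #|eps_Inv (wt j)| *: (invmx (tword p wt (reduced_word (w0 n.+1))) *m v)).
rewrite /nsH vE (DLperm_inv_emb p_neq0 (@dwt_inj n d) (@dwt_wact n d) (@dwt_down n d)).
by rewrite embZ rmorphXn.
Qed.

Lemma nsE_embN : exists g : 'I_N -> 'cV[k]_N, forall j, E (- wt j) = emb wtN (g j).
Proof.
apply: (@fin_all_exists _ (fun=> 'cV[k]_N) (fun j v => E (- wt j) = emb wtN v)) => j.
by apply: (nsE_emb p_neq0 (@dwtN_inj n d) (@dwtN_wact n d) (@dwtN_down n d)); exact: codom_f.
Qed.

Lemma rho_bound j : 0 <= dotw (rho n) (wt j) <= (n * d)%N%:Z.
Proof.
have [ge0 sum_d] := dwt_homw j; apply/andP; split.
  by apply: sumr_ge0 => a _; rewrite mulr_ge0 // ffunE.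
rewrite PoszM -sum_d mulr_sumr; apply: ler_sum => a _; rewrite ler_wpM2r //.
by rewrite ffunE lez_nat leq_subr.
Qed.

Lemma Cauchy_kernel (h g : 'I_N -> 'cV[k]_N) :
    (forall j, nsH p (wt j) = emb wt (h j)) ->
    (forall j, E (- wt j) = emb wtN (g j)) ->
  exists2 B : 'M[k]_N, \sum_j h j *m (g j)^T = B
    & (forall i, t i *m B = B *m (t' i)^T)
      /\ expand (Znum n q) (Zden k n) d = kern wt B.
Proof.
move=> hE gE; have [M M_upper ZE] := Z_kern n q d.
have einj := emb_inj (k := k) (@dwt_inj n d).
have einjN := emb_inj (k := k) (@dwtN_inj n d).
have inv i : t i *m (1%:M - M) = (1%:M - M) *m (t' i)^T.
  apply: (kern_inj (@dwt_inj n d)); rewrite -kern_tX -kern_tY -ZE.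
  exact: Z_invariant.
exists (1%:M - M); last by [].
apply: (dual_bases_kernel (p := p) (t := t) (t' := t') (rho := rho n) (R := (n * d)%N)
  p_neq0 (@dwt_inj n d) (@dwt_wact n d)) => //.
- exact: tmx_supp.
- move=> i l j /tmx_supp[].
  + by move/oppr_inj->; constructor 1.
  + by rewrite /dwtN swapN => /oppr_inj->; constructor 2.
  by rewrite !nrmN; constructor 3.
- exact: (tmx_gt p (@dwt_inj n d)).
- exact: (tmx_quad p (@dwt_inj n d) (@dwt_wact n d) (@dwt_down n d)).
- move=> i j l lt lE; apply: einj; rewrite t_emb -!hE lE.
  exact: nsH_swap.
- move=> i j eq; apply: einj; rewrite t_emb embZ -hE.
  exact: nsH_eq.
- by move=> j dj; apply: einj; rewrite -hE nsH_mon // emb_delta.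
- move=> i j l lt lE; apply: einjN; rewrite t'_emb embZ -!gE lE -swapN.
  by apply: nsE_swap => //; rewrite [X in X < _]ffunE [X in _ < X]ffunE ltrN2.
- by move=> j dj; apply: einjN; rewrite -gE nsE_mon // emb_delta.
- exact: rho_dominant.
exact: rho_bound.
Qed.

(** Letters cross B one at a time, which reverses the word. *)
Lemma kern_tword B s : (forall i, t i *m B = B *m (t' i)^T) ->
  B *m (tword p wtN s)^T = tword p wt (rev s) *m B.
Proof.
move=> inv; elim: s => [|i s IH] /=; first by rewrite trmx1 mulmx1 mul1mx.
rewrite trmx_mul mulmxA IH rev_cons -cats1 tword_cat /= mulmx1 -mulmxA -inv.
by rewrite mulmxA.
Qed.

Lemma rsubst_F sigma lam :
  rsubst Y (nsF_sigma q sigma lam) = psiY (nsE_sigma p (w0 n.+1 * sigma)%g (- lam)).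
Proof.
rewrite /nsF_sigma.
apply: (@ratfun_morph_eq _ _ _ (subst_of yv_indep \o subst_of (@alg_indep_rXV k n.+1)) psiY).
  by move=> c; rewrite /= !subst_of_rC.
move=> a; rewrite psiY_rX -[LHS]/(subst_of yv_indep (subst_of (@alg_indep_rXV k n.+1) (rX k a))).
by rewrite subst_of_rX fmorphV; congr (_^-1); exact: subst_of_rX.
Qed.

Lemma Cauchy_identity (sigma : 'S_n.+1) :
  expand (Znum n q) (Zden k n) d
  = \sum_j rsubst X (nsE_sigma p sigma (wt j)) * rsubst Y (nsF_sigma q sigma (wt j)).
Proof.
have [h hE] := nsH_emb; have [g gE] := nsE_embN.
have [B BE [inv ->]] := Cauchy_kernel hE gE.
pose tau := (sigma^-1)%g; pose w := w0 n.+1.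
have sV : ((w * sigma)^-1 = tau * w)%g by rewrite invMg w0V.
(* The bijection a -> w0 tau a on the weights of degree d. Reindexing by it makes the power of p
   depend on the new index only. *)
have [L LE] : exists L : 'I_N -> 'I_N, forall j, wt (L j) = wact (tau * w)%g (wt j).
  apply: (@fin_all_exists _ (fun=> 'I_N) (fun j l => wt l = wact (tau * w)%g (wt j))) => j.
  by have /codomP[l lE] := dwt_wact (tau * w)%g j; exists l.
have L_inj : injective L.
  move=> j l /(congr1 wt); rewrite !LE => /(can_inj (wactK _)).
  exact: dwt_inj.
pose s := reduced_word tau; pose r := reduced_word (tau * w)%g.
pose s0 := reduced_word w.
have [sE rs] := reduced_wordP tau.
have [rE rr] := reduced_wordP (tau * w)%g.
have [s0E rs0] := reduced_wordP w.
(* T_w0 = T_tau T_((w0 tau)^-1): the concatenated word spells w0 and has the length of w0 by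
   [ninv_w0M], so it is reduced. *)
have tE : tword p wt s0 = tword p wt s *m tword p wt (rev r).
  rewrite -tword_cat.
  have wE : word_perm (s ++ rev r) = w.
    by rewrite word_perm_cat word_perm_rev sE rE invMg -mulgA mulVg mulg1 w0V.
  apply: (tword_eq p (@dwt_inj n d) (@dwt_wact n d) (@dwt_down n d)) => //.
    rewrite /reduced wE size_cat size_rev -(ninv_w0M tau) -/w.
    by move: rs rr; rewrite /reduced sE rE => /eqP-> /eqP->.
  by rewrite s0E wE.
have us : tword p wt s \in unitmx.
  exact: (tword_unit p_neq0 (@dwt_inj n d) (@dwt_wact n d) (@dwt_down n d)).
have ur : tword p wtN r \in unitmx.
  exact: (tword_unit p_neq0 (@dwtN_inj n d) (@dwtN_wact n d) (@dwtN_down n d)).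
pose u l := invmx (tword p wt s) *m (tword p wt s0 *m h l).
pose v l := invmx (tword p wtN r) *m g l.
have key j : rsubst X (nsE_sigma p sigma (wt j)) * rsubst Y (nsF_sigma q sigma (wt j))
    = kern wt (u (L j) *m (v (L j))^T).
  rewrite rsubst_F -[rsubst X _]/(phiX _) /nsE_sigma sV wactN -LE gE.
  (* [DLperm_nsH] read backwards at the weight w0 tau a. The negative power of p is the one that the
     exponents joined by [eps_Inv_split] will cancel. *)
  have Eb : E (wact tau (wt j))
      = emb wt (p ^- #|eps_Inv (wt (L j))| *: (tword p wt s0 *m h (L j))).
    rewrite embZ (emb_tword p (@dwt_inj n d) (@dwt_wact n d) (@dwt_down n d)) -hE.
    rewrite -[foldr _ _ _]/(DLperm p w _) DLperm_nsH // mulrA fmorphV rmorphXn mulVf ?mul1r.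
      by rewrite LE -wactM -mulgA w0K mulg1.
    by rewrite expf_neq0 // fmorph_eq0.
  rewrite Eb (DLperm_inv_emb p_neq0 (@dwt_inj n d) (@dwt_wact n d) (@dwt_down n d)).
  rewrite (DLperm_inv_emb p_neq0 (@dwtN_inj n d) (@dwtN_wact n d) (@dwtN_down n d)).
  rewrite !rmorphM -!rmorphXn phiX_rC psiY_rC mulrACA kern_mul -/s -/r -/(v _).
  rewrite -scalemxAr -/(u _) -scalemxAl -rmorphM -exprD eps_Inv_split -/w -LE.
  rewrite /kern mulr_sumr; apply: eq_bigr => a _; rewrite mulr_sumr; apply: eq_bigr => b _.
  by rewrite [in LHS]mxE mulrA -rmorphM mulrA divff ?mul1r // expf_neq0.
rewrite (eq_bigr _ (fun j _ => key j)) -kern_sum; congr (kern _ _).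
rewrite -(reindex_inj L_inj (P := xpredT) (F := fun l => u l *m (v l)^T)) /=.
have -> : \sum_l u l *m (v l)^T
   = invmx (tword p wt s) *m (tword p wt s0 *m B) *m (invmx (tword p wtN r))^T.
  rewrite -BE mulmx_sumr mulmx_sumr mulmx_suml; apply: eq_bigr => l _.
  by rewrite /u /v trmx_mul !mulmxA.
(* T_w0 B = T_tau T_(rev r) B = T_tau B (T'_r)^T, and both outer factors cancel against the inverses
   in [u] and [v]. *)
rewrite tE -[_ *m tword p wt (rev r) *m B]mulmxA -(kern_tword _ inv) !mulmxA mulVmx // mul1mx -mulmxA -trmx_mul.
by rewrite mulVmx // trmx1 mulmx1.
Qed.

End Cauchy.

Theorem theorem5p1p1 (k : fieldType)
    (iota : {rmorphism {fraction {poly rat}} -> k}) (n : nat)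
    (sigma : 'S_n.+1) :
  let q : k := iota (tofrac 'X) in
  let K := ratfun k (n.+1 + n.+1) in
  let x (i : 'I_n.+1) : K := rX k (lshift n.+1 i) in
  let y (j : 'I_n.+1) : K := rX k (rshift n.+1 j) in
  let t : {poly K} := 'X in
  forall d : nat,
    expand (\prod_(i < n.+1) \prod_(j < n.+1 | (i < j)%N)
              (1 - (rC _ q * x i * y j) *: t))
           (\prod_(i < n.+1) \prod_(j < n.+1 | (i <= j)%N)
              (1 - (x i * y j) *: t)) d
    = \sum_(a : 'X_{1..n.+1 < d.+1} | mdeg a == d)
        rsubst x (nsE_sigma q^-1 sigma (weight_of a))
        * rsubst y (nsF_sigma q sigma (weight_of a)).
Proof.
move=> q K x y t d.
have q_neq0 : q != 0 by rewrite fmorph_eq0 tofrac_eq0 polyX_eq0.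
rewrite -[LHS]/(expand (Znum n q) (Zden k n) d) (Cauchy_identity q_neq0 d sigma).
pose F (a : 'X_{1..n.+1 < d.+1}) := rsubst x (nsE_sigma q^-1 sigma (weight_of a))
  * rsubst y (nsF_sigma q sigma (weight_of a)).
by rewrite -(big_enum_val (A := @dmon n d) F).
Qed.
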